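(* For all integers $n\ge 0$, $$\bar{p}(96n+76)\equiv 0\pmod{2^3\cdot 3^5}.$$
   Context: An overpartition of a nonnegative integer $n$ is a partition of $n$ in which the first occurrence of each part size may or may not be overlined (marked). $\bar{p}(n)$ denotes the number of overpartitions of $n$ (for example $\bar{p}(3)=8$). Its generating function is $$\sum_{n=0}^{\infty}\bar{p}(n)q^n = \frac{(q^2;q^2)_{\infty}}{(q;q)_{\infty}^2},$$ where $(q^a;q^b)_{\infty} := \prod_{m=0}^{\infty}(1-q^{bm+a})$. *)

(* Defs.v *)
From mathcomp Require Import all_boot.

Set Implicit Arguments.
Unset Strict Implicit.
Unset Printing Implicit Defensive.

(* An overpartition is the list of its parts in nonincreasing order, each
   paired with a mark that is true when the part is overlined. The pairwise
   condition says that a part preceded by an equal part is not overlined. *)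
Definition is_overpartition (n : nat) (s : seq (nat * bool)) : bool :=
  [&& all (leq 1) (unzip1 s), sorted geq (unzip1 s), sumn (unzip1 s) == n
    & pairwise (fun x y => (x.1 == y.1) ==> ~~ y.2) s].

(* A partition of n has at most n parts, each at most n, so restricting to
   this finite type of bounded lists loses no overpartition. *)
Definition pbar (n : nat) : nat :=
  #|[set s : {bseq n of 'I_n.+1 * bool}
      | is_overpartition n [seq (val x.1, x.2) | x <- s]]|.

(* Main.v *)
Require Import Defs.
From Stdlib Require Import BinInt.
From HB Require Import structures.
From mathcomp Require Import all_boot all_order all_algebra.
From mathcomp Require Import boolp.
From mathcomp Require Import ssrZ zify ring.

Set Implicit Arguments.
Unset Strict Implicit.
Unset Printing Implicit Defensive.

Import GRing.Theory.
Local Open Scope ring_scope.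

(** Let P be the generating function of overpartitions. Its product formula and
    Gauss's product for phi(q), the sum of the q^(n^2), give P = 1 / phi(-q). The
    theorem is obtained from this by extracting arithmetic progressions of
    exponents, first modulo 32 and then modulo 3.

    Powers of 2. Since phi(q) phi(-q) = phi(-q^2)^2, one has
    P(q) = phi(q) P(q^2)^2. Repeating this turns the factor P into a series in
    q^(2^j), which extraction modulo 2^j does not touch, and leaves powers of
    phi(q), phi(q^2) and so on, whose parity dissections are explicit. The
    outcome (sec_P32) is the closed form
      sum pbar(32 n + 12) q^n = 8 psi^3 E (63 P^8 + 5888 t P^16
                                     + 31744 t^2 P^24 + 32768 t^3 P^32),
    where psi is the sum of the q^(n(n+1)/2), t = 64 q psi^8 and E is an
    Eisenstein series of weight 2. The factor 8 is visible in it.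

    Powers of 3. As 96 n + 76 = 32 (3 n + 2) + 12, it remains to extract the
    exponents congruent to 2 modulo 3. Let v be Ramanujan's cubic continued
    fraction at q^3; it is q times a series in q^3. Up to factors that are series
    in q^3, phi(-q) is 1 - 2v, psi is 1 + v, and E and q psi^8 are polynomials
    in v as well (phi_neg_cubic_frac, psi_cubic_frac, eis_cubic_frac,
    psi_pow8_cubic_frac). Hence the series above, multiplied by an invertible
    series in q^3, becomes a polynomial in v with integer coefficients
    (gf_cubic_frac), and extraction keeps the powers v^j with j congruent to 2
    modulo 3. All the coefficients of these powers are divisible by 243: this
    is a finite computation (poly_total_div), and it proves the theorem.

    The theta function identities have two sources. Jacobi's triple product,
    proved from a finite form, expresses the four theta functions involved as
    quotients of the products (q^d; q^d). The other source is a norm: the product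
    of F(q), F(wq), F(w^2 q) over the cube roots of unity is multiplicative in F,
    can be read off factor by factor on an infinite product, and is a binary cubic
    form in the sections of a theta function; comparing both computations gives
    the cubic identities. The same with F(q) F(-q) gives those of level 4. *)

(** * Power series with integer coefficients *)

(** Series are wrapped in a record so that their product is the Cauchy product
    and not the pointwise product of functions. *)
Record qseries := QSeries { qcoef :> nat -> int }.

HB.instance Definition _ := gen_eqMixin qseries.
HB.instance Definition _ := gen_choiceMixin qseries.

Lemma qseriesP (F G : qseries) : (forall n, F n = G n) -> F = G.
Proof. by case: F G => [f] [g] /= fg; congr QSeries; apply/funext. Qed.

Definition qadd (F G : qseries) := QSeries (fun n => F n + G n).
Definition qopp (F : qseries) := QSeries (fun n => - F n).
Definition qzero := QSeries (fun _ => 0).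
Definition qone := QSeries (fun n => (n == 0)%:R).
Definition qmul (F G : qseries) :=
  QSeries (fun n => \sum_(i < n.+1) F i * G (n - i)%N).

Lemma qaddA : associative qadd.
Proof. by move=> F G H; apply: qseriesP => n /=; rewrite addrA. Qed.
Lemma qaddC : commutative qadd.
Proof. by move=> F G; apply: qseriesP => n /=; rewrite addrC. Qed.
Lemma qadd0 : left_id qzero qadd.
Proof. by move=> F; apply: qseriesP => n /=; rewrite add0r. Qed.
Lemma qaddN : left_inverse qzero qopp qadd.
Proof. by move=> F; apply: qseriesP => n /=; rewrite addNr. Qed.

HB.instance Definition _ := GRing.isZmodule.Build qseries qaddA qaddC qadd0 qaddN.

Definition truncation N (F : qseries) : {poly int} := \poly_(i < N) F i.

(** The ring axioms of the Cauchy product are inherited from polynomials,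
    because a coefficient of a product only depends on truncations. *)
Lemma qmul_truncation N (F G : qseries) n : (n < N)%N ->
  (truncation N F * truncation N G)`_n = qmul F G n.
Proof.
move=> ltnN; rewrite coefM; apply: eq_bigr => i _.
rewrite !coef_poly (leq_ltn_trans (leq_subr i n) ltnN).
by rewrite (leq_ltn_trans _ ltnN) // -ltnS ltn_ord.
Qed.

Lemma qmulA : associative qmul.
Proof.
move=> F G H; apply: qseriesP => n /=.
set t := truncation n.+1.
transitivity ((t F * (t G * t H))`_n).
  rewrite coefM; apply: eq_bigr => i _; rewrite coef_poly ltn_ord.
  by rewrite qmul_truncation // ltnS leq_subr.
rewrite mulrA coefM; apply: eq_bigr => i _.
by rewrite qmul_truncation // coef_poly ltnS leq_subr.
Qed.

Lemma qmulC : commutative qmul.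
Proof.
move=> F G; apply: qseriesP => n.
by rewrite -!(qmul_truncation _ _ (ltnSn n)) mulrC.
Qed.

Lemma qmul1 : left_id qone qmul.
Proof.
move=> F; apply: qseriesP => n /=; rewrite big_ord_recl /= mul1r subn0.
by rewrite big1 ?addr0 // => i _; rewrite mul0r.
Qed.

Lemma qmulDl : left_distributive qmul qadd.
Proof.
move=> F G H; apply: qseriesP => n /=; rewrite -big_split.
by apply: eq_bigr => i _; rewrite mulrDl.
Qed.

Lemma qone_neq0 : qone != 0.
Proof. by apply/eqP => /(congr1 (fun F => qcoef F 0)). Qed.

HB.instance Definition _ := GRing.Zmodule_isComNzRing.Build qseries
  qmulA qmulC qmul1 qmulDl qone_neq0.

Implicit Types F G H : qseries.

Lemma qcoefD F G n : (F + G) n = F n + G n. Proof. by []. Qed.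
Lemma qcoefN F n : (- F) n = - F n. Proof. by []. Qed.
Lemma qcoefB F G n : (F - G) n = F n - G n. Proof. by []. Qed.
Lemma qcoef1 n : (1 : qseries) n = (n == 0)%:R. Proof. by []. Qed.
Lemma qcoefM F G n : (F * G) n = \sum_(i < n.+1) F i * G (n - i)%N.
Proof. by []. Qed.
Lemma qcoef_sum I (r : seq I) (P : pred I) (E : I -> qseries) n :
  (\sum_(i <- r | P i) E i) n = \sum_(i <- r | P i) E i n.
Proof. by elim/big_rec2: _ => // i x y _ <-. Qed.
Lemma qcoefMn F k n : (F *+ k) n = F n *+ k.
Proof. by elim: k => // k IHk; rewrite !mulrS qcoefD IHk. Qed.

Lemma qcoefM0 F G : (F * G) 0%N = F 0%N * G 0%N.
Proof. by rewrite qcoefM big_ord1. Qed.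
Lemma qcoefX0 F k : (F ^+ k) 0%N = F 0%N ^+ k.
Proof. by elim: k => // k IHk; rewrite !exprS qcoefM0 IHk. Qed.

(** * Congruence modulo a power of q *)

(** F = G modulo q^N. *)
Definition agree N F G := forall n, (n < N)%N -> F n = G n.

Lemma agree_sym N F G : agree N F G -> agree N G F.
Proof. by move=> FG n ltnN; rewrite FG. Qed.
Lemma agree_trans N G F H : agree N F G -> agree N G H -> agree N F H.
Proof. by move=> FG GH n ltnN; rewrite FG ?GH. Qed.
Lemma agree_le M N F G : (M <= N)%N -> agree N F G -> agree M F G.
Proof. by move=> leMN FG n ltnM; apply: FG; apply: leq_trans leMN. Qed.
Lemma agreeD N F F' G G' : agree N F F' -> agree N G G' ->
  agree N (F + G) (F' + G').
Proof. by move=> FF GG n ltnN; rewrite !qcoefD FF ?GG. Qed.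
Lemma agreeN N F F' : agree N F F' -> agree N (- F) (- F').
Proof. by move=> FF n ltnN; rewrite !qcoefN FF. Qed.
Lemma agreeM N F F' G G' : agree N F F' -> agree N G G' ->
  agree N (F * G) (F' * G').
Proof.
move=> FF GG n ltnN; rewrite !qcoefM; apply: eq_bigr => i _.
by rewrite FF ?GG // (leq_ltn_trans _ ltnN) ?leq_subr // -ltnS.
Qed.
Lemma agree_sum I (r : seq I) (P : pred I) (E E' : I -> qseries) N :
  (forall i, P i -> agree N (E i) (E' i)) ->
  agree N (\sum_(i <- r | P i) E i) (\sum_(i <- r | P i) E' i).
Proof. by move=> EE; elim/big_rec2: _ => // i x y /EE; apply: agreeD. Qed.
Lemma agree_prod I (r : seq I) (P : pred I) (E E' : I -> qseries) N :
  (forall i, P i -> agree N (E i) (E' i)) ->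
  agree N (\prod_(i <- r | P i) E i) (\prod_(i <- r | P i) E' i).
Proof. by move=> EE; elim/big_rec2: _ => // i x y /EE; apply: agreeM. Qed.
Lemma agree_eq F G : (forall N, agree N F G) -> F = G.
Proof. by move=> FG; apply: qseriesP => n; apply: (FG n.+1). Qed.

Lemma agree_cancel N F G H : F 0%N = 1 -> agree N (F * G) (F * H) -> agree N G H.
Proof.
move=> F0 FGH n; elim/ltn_ind: n => n IHn ltnN.
move: (FGH n ltnN); rewrite !qcoefM !big_ord_recl /= subn0 F0 !mul1r.
rewrite (eq_bigr (fun i : 'I_n => F (lift ord0 i) * H (n - lift ord0 i)%N)).
  by move/addIr.
move=> i _; congr (_ * _); apply: IHn; rewrite /= /bump /=; last first.
  by rewrite (leq_ltn_trans (leq_subr _ _)).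
by rewrite add1n subnSK // leq_subr.
Qed.

Lemma mulI_coef0_1 F G H : F 0%N = 1 -> F * G = F * H -> G = H.
Proof.
by move=> F0 FGH; apply: agree_eq => N; apply: (agree_cancel F0); rewrite FGH.
Qed.

Lemma mulI_coef0_neq0 F G : F 0%N != 0 -> F * G = 0 -> G = 0.
Proof.
move=> F0 FG; apply: qseriesP; elim/ltn_ind => n IHn.
have := congr1 (fun K => qcoef K n) FG.
rewrite qcoefM big_ord_recl /= subn0 big1 => [|i _]; last first.
  by rewrite IHn ?mulr0 // /bump /= add1n subnSK // leq_subr.
by rewrite addr0 => /eqP; rewrite mulf_eq0 (negPf F0) => /eqP.
Qed.

(** The inverse is the geometric series in 1 - F, whose k-th power is divisible
    by q^k. *)
Lemma inverse_exists F : F 0%N = 1 -> exists G, F * G = 1.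
Proof.
move=> F0.
have low (G : qseries) k : G 0%N = 0 -> forall n, (n < k)%N -> (G ^+ k) n = 0.
  move=> G0; elim: k => // k IHk n ltnk; rewrite exprS qcoefM.
  rewrite big1 // => [[i] /= ltin] _; case: i ltin => [|i] ltin.
    by rewrite G0 mul0r.
  by rewrite IHk ?mulr0 //; lia.
pose S k := \sum_(i < k) (1 - F) ^+ i.
have FS k : F * S k = 1 - (1 - F) ^+ k.
  elim: k => [|k IHk]; first by rewrite /S big_ord0 expr0; ring.
  by rewrite /S big_ord_recr /= -/(S k) mulrDr IHk exprS; ring.
have D0 : (1 - F) 0%N = 0 by rewrite qcoefB F0.
exists (QSeries (fun n => S n.+1 n)); apply: agree_eq => N.
apply: (@agree_trans _ (F * S N)); last first.
  by move=> n ltnN; rewrite FS qcoefB (low _ _ D0) ?subr0.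
apply: agreeM => // n ltnN /=.
rewrite /S !qcoef_sum -!(big_mkord xpredT (fun i => ((1 - F) ^+ i) n)).
rewrite (big_cat_nat (n := n.+1) (p := N)) //= [X in _ = _ + X]big_nat_cond.
rewrite [X in _ = _ + X]big1 ?addr0 // => i /andP[/andP[lti _] _].
by rewrite (low _ _ D0).
Qed.

Definition qX : qseries := QSeries (fun n => (n == 1%N)%:R).
Notation "'q" := qX.

Lemma qcoefXM F n : ('q * F) n = if n is m.+1 then F m else 0.
Proof.
case: n => [|n]; first by rewrite qcoefM0 mul0r.
rewrite qcoefM !big_ord_recl /= mul0r add0r mul1r subn1 /= big1 ?addr0 //.
by move=> i _; rewrite mul0r.
Qed.

Lemma qcoefXnM k F n : ('q ^+ k * F) n = if (n < k)%N then 0 else F (n - k)%N.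
Proof.
elim: k n => [|k IHk] n; first by rewrite expr0 mul1r subn0.
by rewrite exprS -mulrA qcoefXM; case: n => [|n] //; rewrite IHk.
Qed.

Lemma qcoefXn k n : ('q ^+ k) n = (n == k)%:R.
Proof.
rewrite -['q ^+ k]mulr1 qcoefXnM qcoef1; case: ltngtP => //= [kn|->].
  by rewrite -[_ == 0%N]negbK -lt0n subn_gt0 kn.
by rewrite subnn.
Qed.

Lemma agreeXn0 N k F : (N <= k)%N -> agree N ('q ^+ k * F) 0.
Proof. by move=> leNk n ltnN; rewrite qcoefXnM (leq_trans ltnN). Qed.

Lemma agreeXnM N k F G : agree (N - k) F G ->
  agree N ('q ^+ k * F) ('q ^+ k * G).
Proof.
move=> FG n ltnN; rewrite !qcoefXnM; case: ltnP => // lekn.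
by rewrite FG // ltn_sub2r // (leq_ltn_trans lekn).
Qed.

(** * Dissection *)

(** F(q^d). *)
Definition dil d F := QSeries (fun n => if (d %| n)%N then F (n %/ d)%N else 0).

(** The sections of F: it is the sum over r < d of q^r (sec d r F)(q^d). *)
Definition sec d r F := QSeries (fun n => F (d * n + r)%N).

Lemma secD d r F G : sec d r (F + G) = sec d r F + sec d r G.
Proof. exact: qseriesP. Qed.

(** A factor that is a series in q^d does not mix the residues of exponents
    modulo d. Every extraction of exponents below rests on this. *)
Lemma sec_dilM d r F G : (r < d)%N ->
  sec d r (dil d F * G) = F * sec d r G.
Proof.
move=> ltrd; have d_gt0 : (0 < d)%N by apply: leq_ltn_trans ltrd.
apply: qseriesP => n.
change ((dil d F * G) (d * n + r)%N = (F * sec d r G) n); rewrite !qcoefM.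
pose h (i : 'I_n.+1) : 'I_(d * n + r).+1 := inord (d * i).
have hE i : h i = (d * i)%N :> nat.
  by rewrite inordK // ltnS (leq_trans _ (leq_addr r _)) // leq_mul2l -ltnS ltn_ord orbT.
rewrite (bigID (fun i : 'I__ => d %| i)%N) /= [X in _ + X]big1 => [|i /negPf ->]; last first.
  by rewrite mul0r.
rewrite addr0 (reindex_onto h (fun j : 'I__ => inord (j %/ d))) /=; last first.
  move=> j dj; apply: val_inj; rewrite /= hE inordK; first by rewrite mulnC divnK.
  rewrite ltn_divLR // (leq_trans (ltn_ord j)) //.
  by rewrite (mulnC n.+1) mulnS [leqRHS]addnC -addnS leq_add2l.
apply: eq_big => [i|i _].
  rewrite hE dvdn_mulr //= mulKn //; apply/eqP/val_inj => /=.
  by rewrite inordK.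
rewrite hE dvdn_mulr // mulKn //; congr (_ * G _).
by have := ltn_ord i; nia.
Qed.

Lemma sec_dil d r F : (r < d)%N -> sec d r (dil d F) = if r == 0%N then F else 0.
Proof.
move=> ltrd; have d_gt0 : (0 < d)%N by apply: leq_ltn_trans ltrd.
apply: qseriesP => n /=; rewrite dvdn_addr ?dvdn_mulr //.
case: eqP => [->|/eqP r0]; first by rewrite dvdn0 addn0 mulKn.
by rewrite gtnNdvd // lt0n.
Qed.

Lemma sec_eq d F G : (0 < d)%N -> (forall r, (r < d)%N -> sec d r F = sec d r G) ->
  F = G.
Proof.
move=> d_gt0 FG; apply: qseriesP => n.
have := congr1 (fun K => qcoef K (n %/ d)) (FG (n %% d)%N (ltn_pmod n d_gt0)).
by rewrite /= mulnC -divn_eq.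
Qed.

Lemma dilM d F G : (0 < d)%N -> dil d (F * G) = dil d F * dil d G.
Proof.
move=> d_gt0; apply: (sec_eq d_gt0) => r ltrd; rewrite sec_dilM // !sec_dil //.
by case: eqP; rewrite ?mulr0.
Qed.
Lemma dilD d F G : dil d (F + G) = dil d F + dil d G.
Proof. by apply: qseriesP => n /=; case: ifP; rewrite ?addr0. Qed.
Lemma dilN d F : dil d (- F) = - dil d F.
Proof. by apply: qseriesP => n /=; case: ifP; rewrite ?oppr0. Qed.
Lemma dil1 d : (0 < d)%N -> dil d 1 = 1.
Proof.
move=> d_gt0; apply: (sec_eq d_gt0) => r ltrd; rewrite sec_dil //.
apply: qseriesP => n /=; case: (r =P 0%N) => [->|/eqP r0].
  by rewrite addn0 muln_eq0 -[d == _]negbK -lt0n d_gt0.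
by rewrite addn_eq0 (negPf r0) andbF.
Qed.
Fact dil_zmod_morphism d : zmod_morphism (dil d).
Proof. by move=> F G; rewrite dilD dilN. Qed.
HB.instance Definition _ d :=
  GRing.isZmodMorphism.Build qseries qseries (dil d) (dil_zmod_morphism d).

Fact dil_monoid_morphism d : monoid_morphism (dil d.+1).
Proof. by split; [exact: dil1 | move=> F G; exact: dilM]. Qed.
HB.instance Definition _ d :=
  GRing.isMonoidMorphism.Build qseries qseries (dil d.+1) (dil_monoid_morphism d).

Lemma dilX d F k : (0 < d)%N -> dil d (F ^+ k) = dil d F ^+ k.
Proof.
by move=> d_gt0; elim: k => [|k IHk]; rewrite ?dil1 // !exprS dilM // IHk.
Qed.
Lemma dil_nat d k : (0 < d)%N -> dil d k%:R = k%:R.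
Proof.
move=> d_gt0; elim: k => [|k IHk]; last by rewrite mulrS dilD IHk dil1 // mulrS.
by apply: qseriesP => n /=; case: ifP.
Qed.
Lemma dil_prod d I (s : seq I) (P : pred I) (E : I -> qseries) : (0 < d)%N ->
  dil d (\prod_(i <- s | P i) E i) = \prod_(i <- s | P i) dil d (E i).
Proof.
by move=> d_gt0; elim/big_rec2: _ => [|i x y _ <-]; rewrite ?dil1 ?dilM.
Qed.
Lemma dil_dil d e F : (0 < d)%N -> (0 < e)%N -> dil d (dil e F) = dil (d * e) F.
Proof.
move=> d_gt0 e_gt0; apply: (sec_eq d_gt0) => r ltrd; rewrite sec_dil //.
apply: qseriesP => n /=; case: (r =P 0%N) => [->|/eqP r0].
  by rewrite addn0 dvdn_pmul2l // divnMl.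
case: ifP => // /(dvdn_trans (dvdn_mulr e (dvdnn d))).
by rewrite dvdn_addr ?dvdn_mulr // gtnNdvd // lt0n.
Qed.
Lemma dil_q d : (0 < d)%N -> dil d 'q = 'q ^+ d.
Proof.
move=> d_gt0; apply: qseriesP => n /=; rewrite qcoefXn.
case: ifP => [/dvdnP[k ->]|ndn].
  by rewrite mulnK // -[X in (_ * _ == X)%N]mul1n eqn_pmul2r.
by case: eqP => // nd; rewrite nd dvdnn in ndn.
Qed.
Lemma dil_inj d F G : (0 < d)%N -> dil d F = dil d G -> F = G.
Proof. by move=> d0 /(congr1 (sec d 0)); rewrite !sec_dil. Qed.
Lemma dil_coef0 d F : dil d F 0%N = F 0%N.
Proof. by rewrite /= dvdn0 div0n. Qed.

Lemma sec_qdil d r j s F : (s < d)%N -> (r < d)%N ->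
  sec d r ('q ^+ (d * j + s) * dil d F) = if r == s then 'q ^+ j * F else 0.
Proof.
move=> ltsd ltrd; have d_gt0 : (0 < d)%N by apply: leq_ltn_trans ltrd.
apply: qseriesP => n; rewrite -[LHS]/(('q ^+ _ * _) (d * n + r)%N) qcoefXnM /=.
have [<-|/eqP neqrs] := r =P s.
  rewrite ltn_add2r ltn_pmul2l // qcoefXnM; case: ltnP => // lejn.
  by rewrite subnDr -mulnBr dvdn_mulr // mulKn.
case: ltnP => // le; rewrite ifF //; apply/negP => /dvdnP[k nk].
have {nk} nk : (d * n + r = d * (k + j) + s)%N by nia.
have := congr1 (modn^~ d) nk; rewrite /= !(mulnC d) !modnMDl !modn_small // => rs.
by rewrite rs eqxx in neqrs.
Qed.

Lemma agree_dil d N F G : (0 < d)%N -> agree N F G -> agree N (dil d F) (dil d G).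
Proof.
move=> d_gt0 FG n ltnN /=; case: ifP => // _; apply: FG.
exact: leq_ltn_trans (leq_div n d) ltnN.
Qed.
Lemma agree_sec d r N F G : (r < d)%N -> agree (d * N) F G ->
  agree N (sec d r F) (sec d r G).
Proof. by move=> ltrd FG n ltnN /=; apply: FG; nia. Qed.

(** * Infinite sums and products *)

(** Since q^k divides the term of index k, the terms up to n determine the
    coefficient of q^n. *)
Definition summable (s : nat -> qseries) := forall k, agree k (s k) 0.
Definition infsum (s : nat -> qseries) :=
  QSeries (fun n => (\sum_(k < n.+1) s k) n).

(** The factor of index k only affects coefficients beyond q^k, so the factors
    before n determine the coefficient of q^n. *)
Definition multipliable (s : nat -> qseries) := forall k, agree k.+1 (s k) 1.
Definition infprod (s : nat -> qseries) :=
  QSeries (fun n => (\prod_(k < n) s k) n).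

Lemma agree_ordsum (s : nat -> qseries) M N : summable s -> (N <= M)%N ->
  agree N (\sum_(k < M) s k) (\sum_(k < N) s k).
Proof.
move=> s0 leNM; rewrite -!(big_mkord xpredT) (big_cat_nat (n := N)) //=.
rewrite -[X in agree _ _ X]addr0; apply: agreeD => //.
rewrite big_nat_cond; elim/big_rec: _ => // i x /andP[/andP[leNi _] _] xN.
by rewrite -[0]addr0; apply: agreeD => //; apply: (agree_le _ (s0 i)).
Qed.

Lemma agree_infsum (s : nat -> qseries) N : summable s ->
  agree N (infsum s) (\sum_(k < N) s k).
Proof.
by move=> s0 n ltnN; rewrite (agree_ordsum (M := N) s0 ltnN).
Qed.

Lemma agree_ordprod (s : nat -> qseries) M N : multipliable s -> (N <= M)%N ->
  agree N.+1 (\prod_(k < M) s k) (\prod_(k < N) s k).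
Proof.
move=> s1 leNM; rewrite -!(big_mkord xpredT) (big_cat_nat (n := N)) //=.
rewrite -[X in agree _ _ X]mulr1; apply: agreeM => //.
rewrite big_nat_cond; elim/big_rec: _ => // i x /andP[/andP[leNi _] _] xN.
by rewrite -[1]mulr1; apply: agreeM => //; apply: (agree_le _ (s1 i)).
Qed.

Lemma agree_infprod (s : nat -> qseries) N : multipliable s ->
  agree N.+1 (infprod s) (\prod_(k < N) s k).
Proof.
by move=> s1 n ltnN; rewrite (agree_ordprod (M := N) (N := n) s1).
Qed.

Lemma eq_infsum s t : s =1 t -> infsum s = infsum t.
Proof.
by move=> st; apply: qseriesP => n /=; rewrite (eq_bigr (fun i : 'I__ => t i)).
Qed.

Lemma eq_infprod s t : s =1 t -> infprod s = infprod t.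
Proof.
by move=> st; apply: qseriesP => n /=; rewrite (eq_bigr (fun i : 'I__ => t i)).
Qed.

Lemma infprod_coef0 s : infprod s 0%N = 1.
Proof. by rewrite /= big_ord0. Qed.

Lemma summableM G s : summable s -> summable (fun k => G * s k).
Proof. by move=> s0 k; rewrite -[0](mulr0 G); apply: agreeM. Qed.

Lemma infsumM G s : summable s -> infsum (fun k => G * s k) = G * infsum s.
Proof.
move=> s0; apply: agree_eq => N; apply: (agree_trans (agree_infsum (summableM G s0))).
by rewrite -mulr_sumr; apply: agreeM => //; apply/agree_sym/agree_infsum.
Qed.

Lemma infsum_recl s : summable s -> infsum s = s 0%N + infsum (fun k => s k.+1).
Proof.
move=> s0; have s1 : summable (fun k => s k.+1).
  by move=> k; apply: (agree_le _ (s0 k.+1)).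
apply: agree_eq => N; apply: (agree_trans (agree_le (leqnSn N) (agree_infsum s0))).
rewrite big_ord_recl; apply: agreeD => //.
by apply: agree_sym; apply: agree_infsum.
Qed.

Lemma infsum_dil d s : (0 < d)%N -> summable s ->
  dil d (infsum s) = infsum (fun k => dil d (s k)).
Proof.
move=> d_gt0 s0.
have dil0 : dil d 0 = 0 by rewrite -[0]/(0%:R) dil_nat.
have sd : summable (fun k => dil d (s k)).
  by move=> k; rewrite -dil0; apply: agree_dil.
apply: agree_eq => N; apply: (agree_trans (agree_dil d_gt0 (agree_infsum s0))).
apply: agree_sym; apply: (agree_trans (agree_infsum sd)).
elim: N => [|N IHN]; first by rewrite !big_ord0 dil0.
by elim/big_rec2: _ => [|i x y _ yx]; rewrite ?dil0 // dilD; apply: agreeD.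
Qed.

Lemma summable_sub s m r : (0 < m)%N -> summable s ->
  summable (fun k => s (m * k + r)%N).
Proof. by move=> m_gt0 s0 k; apply: (agree_le _ (s0 _)); nia. Qed.

Lemma big_ordMn (R : Type) (idx : R) (op : Monoid.law idx) m N (E : nat -> R) :
  \big[op/idx]_(k < N * m) E k =
  \big[op/idx]_(k < N) \big[op/idx]_(r < m) E (m * k + r)%N.
Proof.
rewrite -(big_mkord xpredT) big_nat_mul big_mkord; apply: eq_bigr => k _.
rewrite -{1}[(k * m)%N]add0n mulSn big_addn addnK big_mkord.
by apply: eq_bigr => r _; rewrite addnC mulnC.
Qed.

Lemma infsum_split m s : (0 < m)%N -> summable s ->
  infsum s = \sum_(r < m) infsum (fun k => s (m * k + r)%N).
Proof.
move=> m_gt0 s0; apply: agree_eq => N.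
apply: (@agree_trans _ (\sum_(k < N * m) s k)).
  by apply: (agree_le _ (agree_infsum s0)); rewrite leq_pmulr.
rewrite big_ordMn exchange_big /=; apply: agree_sum => r _; apply: agree_sym.
by apply: agree_infsum; apply: summable_sub.
Qed.

Lemma multipliable_sub s m r : (0 < m)%N -> multipliable s ->
  multipliable (fun k => s (m * k + r)%N).
Proof. by move=> m_gt0 s1 k; apply: (agree_le _ (s1 _)); nia. Qed.

Lemma infprod_split m s : (0 < m)%N -> multipliable s ->
  infprod s = \prod_(r < m) infprod (fun k => s (m * k + r)%N).
Proof.
move=> m_gt0 s1; apply: agree_eq => N; apply: (@agree_le _ N.+1) => //.
apply: (@agree_trans _ (\prod_(k < N * m) s k)).
  by apply: (agree_le _ (agree_infprod s1)); rewrite ltnS leq_pmulr.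
rewrite big_ordMn exchange_big /=; apply: agree_prod => r _; apply: agree_sym.
by apply: agree_infprod; apply: multipliable_sub.
Qed.

Lemma multipliableM s t : multipliable s -> multipliable t ->
  multipliable (fun k => s k * t k).
Proof. by move=> s1 t1 k; rewrite -[1]mulr1; apply: agreeM. Qed.

Lemma infprodM s t : multipliable s -> multipliable t ->
  infprod (fun k => s k * t k) = infprod s * infprod t.
Proof.
move=> s1 t1; apply: agree_eq => N; apply: (@agree_le _ N.+1) => //.
apply: (agree_trans (agree_infprod (multipliableM s1 t1))).
by rewrite big_split; apply: agreeM; apply/agree_sym/agree_infprod.
Qed.

Lemma multipliable_dil d s : (0 < d)%N -> multipliable s ->
  multipliable (fun k => dil d (s k)).
Proof. by move=> d_gt0 s1 k; rewrite -(dil1 d_gt0); apply: agree_dil. Qed.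

Lemma infprod_dil d s : (0 < d)%N -> multipliable s ->
  dil d (infprod s) = infprod (fun k => dil d (s k)).
Proof.
move=> d_gt0 s1; apply: agree_eq => N; apply: (@agree_le _ N.+1) => //.
apply: (agree_trans (agree_dil d_gt0 (agree_infprod s1))).
rewrite dil_prod //; apply/agree_sym/agree_infprod.
exact: multipliable_dil.
Qed.

(** * q-Pochhammer products *)

Definition sign (e : bool) : qseries := (-1) ^+ e.

Lemma sign_sq e : sign e * sign e = 1.
Proof. by case: e; rewrite /sign ?expr1 ?expr0; ring. Qed.

Lemma dil_sign d e : (0 < d)%N -> dil d (sign e) = sign e.
Proof. by move=> d_gt0; rewrite dilX // dilN dil1. Qed.

(** The q-Pochhammer symbol (q^a; q^d) if e holds, and (-q^a; q^d) otherwise. *)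
Definition poch e a d := infprod (fun k => 1 + 'q ^+ (d * k + a) * sign e).

Lemma poch_multipliable e a d : (0 < a)%N -> (0 < d)%N ->
  multipliable (fun k => 1 + 'q ^+ (d * k + a) * sign e).
Proof.
move=> a0 d0 k; rewrite -[X in agree _ _ X]addr0; apply: agreeD => //.
by apply: agreeXn0; nia.
Qed.

Lemma poch_dil m e a d : (0 < m)%N -> (0 < a)%N -> (0 < d)%N ->
  dil m (poch e a d) = poch e (m * a) (m * d).
Proof.
move=> m0 a0 d0; rewrite infprod_dil //; last exact: poch_multipliable.
apply: eq_infprod => k; rewrite dilD dil1 // dilM // dilX // dil_q // dil_sign //.
by rewrite -exprM mulnDr mulnA.
Qed.

Lemma poch_split m e a d : (0 < m)%N -> (0 < a)%N -> (0 < d)%N ->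
  poch e a d = \prod_(r < m) poch e (a + d * r) (m * d).
Proof.
move=> m0 a0 d0; rewrite {1}/poch (infprod_split m0); last exact: poch_multipliable.
apply: eq_bigr => r _; apply: eq_infprod => k; congr (1 + 'q ^+ _ * _); nia.
Qed.

Lemma poch_coef0 e a d : poch e a d 0%N = 1.
Proof. exact: infprod_coef0. Qed.

(** Multiply (1 + q^k)(1 - q^k) = 1 - q^(2k) over k > 0. *)
Lemma poch_plus_minus : poch false 1 1 * poch true 1 1 = dil 2 (poch true 1 1).
Proof.
rewrite poch_dil // -infprodM; do ?exact: poch_multipliable.
apply: eq_infprod => k.
by rewrite /sign (_ : (2 * 1 * k + 2 * 1) = (1 * k + 1) * 2)%N ?exprM; [ring | lia].
Qed.

(** * Jacobi's triple product *)

Section FiniteTripleProduct.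

Variable R : comNzRingType.
Implicit Types Q x y : R.

(** With Q = x y, the product of the (1 + x Q^i)(1 + y Q^i) over i < N is a
    combination of the monomials x^(k(k+1)/2) y^(k(k-1)/2) for |k| <= N. The
    coefficients are defined here by the recursion on N that the next two factors
    impose; they are the Gaussian binomials [2N choose N + k]. Exchanging x and y
    turns k into -k, so that k >= 0 suffices, the neighbour -1 of 0 being
    replaced with 1. *)
Fixpoint jcoef Q N k : R :=
  if N is M.+1 then
    (1 + Q ^+ (2 * M + 1)) * jcoef Q M k
    + (if k is j.+1 then Q ^+ (M - j) * jcoef Q M j else Q ^+ M.+1 * jcoef Q M 1)
    + Q ^+ (M + k + 1) * jcoef Q M k.+1
  else (k == 0)%:R.

Lemma expr_double Q N : Q ^+ (2 * N) = Q ^+ N * Q ^+ N.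
Proof. by rewrite mul2n -addnn exprD. Qed.

Lemma expr_double1 Q N : Q ^+ (2 * N + 1) = Q ^+ N * Q ^+ N * Q.
Proof. by rewrite exprD expr_double expr1. Qed.

Lemma jcoef_gt Q N k : (N < k)%N -> jcoef Q N k = 0.
Proof.
elim: N k => [|N IHN] [|k] //= ltNk.
by rewrite !IHN ?mulr0 ?addr0 // ltnW // ltnW.
Qed.

Definition jterm x y k := x ^+ 'C(k.+1, 2) * y ^+ 'C(k, 2).

Lemma jtermS x y k : jterm x y k.+1 = jterm x y k * x * (x * y) ^+ k.
Proof. by rewrite /jterm !(binS _ 1) !bin1 !exprD exprMn exprS; ring. Qed.

(** Multiplication by x Q^N raises the index k by one and multiplication by y Q^N
    lowers it; the last two terms correct for the passage between k = 0 and
    k = 1. *)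
Lemma jcoef_step x y N M : (N < M)%N ->
  let Q := x * y in
  let T L := \sum_(k < M) jcoef Q L k.+1 * jterm x y k.+1 in
  T N.+1 = (1 + Q ^+ (2 * N + 1) + (x + y) * Q ^+ N) * T N
           + Q ^+ N * jcoef Q N 0 * x - Q ^+ N.+1 * jcoef Q N 1.
Proof.
case: M => // M; rewrite ltnS => leNM Q T; have QE : Q = x * y by [].
have Tx : x * Q ^+ N * T N + Q ^+ N * jcoef Q N 0 * x =
    \sum_(k < M.+1) Q ^+ (N - k) * jcoef Q N k * jterm x y k.+1.
  rewrite [RHS]big_ord_recl /T big_ord_recr /= jcoef_gt // mul0r addr0 addrC.
  rewrite subn0 {2}/jterm /= expr0 expr1 mulr1; congr (_ + _).
  rewrite mulr_sumr; apply: eq_bigr => k _; rewrite /bump /= add1n.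
  have [leN|ltN] := leqP N k; first by rewrite jcoef_gt // !(mulr0, mul0r).
  rewrite (jtermS _ _ k.+1) -/Q.
  have -> : Q ^+ N = Q ^+ (N - k.+1) * Q ^+ k.+1 by rewrite -exprD subnK.
  by ring.
have Ty : y * Q ^+ N * T N =
    Q ^+ N.+1 * jcoef Q N 1
    + \sum_(k < M.+1) Q ^+ (N + k.+1 + 1) * jcoef Q N k.+2 * jterm x y k.+1.
  rewrite /T mulr_sumr big_ord_recl big_ord_recr /= (@jcoef_gt _ _ M.+2); last by rewrite ltnS leqW.
  rewrite mulr0 mul0r addr0; congr (_ + _).
    by rewrite jtermS /jterm /= !expr0 exprS -/Q; ring: QE.
  apply: eq_bigr => k _; rewrite /bump /= !add1n (jtermS _ _ k.+1) -/Q.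
  by rewrite !exprD expr1; ring: QE.
transitivity ((1 + Q ^+ (2 * N + 1)) * T N
  + (x * Q ^+ N * T N + Q ^+ N * jcoef Q N 0 * x)
  + (y * Q ^+ N * T N - Q ^+ N.+1 * jcoef Q N 1)); last by ring.
rewrite Tx Ty [X in _ + X]addrAC subrr add0r /T mulr_sumr -!big_split /=.
by apply: eq_bigr => k _; rewrite !mulrDl !mulrA.
Qed.

(** The bound M is independent of N for the induction; the coefficients vanish
    beyond N. *)
Lemma finite_triple_product x y M N : (N <= M)%N ->
  \prod_(i < N) ((1 + x * (x * y) ^+ i) * (1 + y * (x * y) ^+ i)) =
  jcoef (x * y) N 0
  + (\sum_(k < M) jcoef (x * y) N k.+1 * jterm x y k.+1
     + \sum_(k < M) jcoef (x * y) N k.+1 * jterm y x k.+1).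
Proof.
elim: N => [_|N IHN ltNM].
  by rewrite big_ord0 !big1 ?addr0 // => k _; rewrite mul0r.
rewrite big_ord_recr /= (IHN (ltnW ltNM)).
have := jcoef_step x y ltNM; have := jcoef_step y x ltNM.
rewrite (mulrC y x) /= => -> ->.
set S := (\sum_(k < M) _); set S' := (\sum_(k < M) _).
set c0 := jcoef _ N 0; set c1 := jcoef _ N 1.
rewrite addn0 expr_double1 !addn1 !exprS.
by ring.
Qed.

Definition qfact Q m := \prod_(i < m) (1 - Q ^+ i.+1).

Lemma qfactS Q m : qfact Q m.+1 = qfact Q m * (1 - Q ^+ m.+1).
Proof. exact: big_ord_recr. Qed.

(** This is the factorial formula for [2N choose N + k], which gives the limit of
    the coefficients when N grows. Each summand of their recursion becomes a
    multiple of (Q; Q)_(2N), and the sum of the three multiples is an identity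
    between polynomials in Q, Q^k and Q^(N-k). *)
Lemma jcoef_qfact Q N k : (k <= N)%N ->
  jcoef Q N k * qfact Q (N + k) * qfact Q (N - k) = qfact Q (2 * N).
Proof.
elim: N k => [|N IHN] k lekN.
  by move: lekN; rewrite leqn0 => /eqP ->; rewrite /= /qfact big_ord0; ring.
have -> : (2 * N.+1 = (2 * N).+2)%N by lia.
rewrite [qfact Q (2 * N).+2]qfactS [qfact Q (2 * N).+1]qfactS.
(* For j = N both sides vanish, as jcoef is 0 beyond N and 1 - Q^0 = 0. *)
have next j : (j <= N)%N ->
    jcoef Q N j.+1 * qfact Q (N.+1 + j) * qfact Q (N.+1 - j) =
    qfact Q (2 * N) * (1 - Q ^+ (N - j)) * (1 - Q ^+ (N - j).+1).
  rewrite leq_eqVlt => /orP[/eqP ->|ltjN].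
    by rewrite jcoef_gt // subnn expr0; ring.
  rewrite -(IHN j.+1) // addSnnS.
  have -> : (N.+1 - j = (N - j.+1).+2)%N by lia.
  have -> : (N - j = (N - j.+1).+1)%N by lia.
  by rewrite !qfactS; ring.
have [ltNk|lekN'] := ltnP N k.
  have {ltNk lekN}-> : k = N.+1 by apply/eqP; rewrite eqn_leq lekN.
  rewrite [jcoef Q N.+1 N.+1]/= (jcoef_gt Q (ltnSn N)) (jcoef_gt Q (leqW (ltnSn N))).
  rewrite !subnn expr0.
  rewrite (_ : (N.+1 + N.+1 = (N + N).+2)%N) ?qfactS; last by lia.
  by rewrite -(IHN N) // subnn mul2n -addnn; ring.
have here : jcoef Q N k * qfact Q (N.+1 + k) * qfact Q (N.+1 - k) =
    qfact Q (2 * N) * (1 - Q ^+ (N + k).+1) * (1 - Q ^+ (N - k).+1).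
  by rewrite -(IHN k) // addSn subSn // !qfactS; ring.
have prev : (if k is j.+1 then Q ^+ (N - j) * jcoef Q N j
             else Q ^+ N.+1 * jcoef Q N 1)
      * qfact Q (N.+1 + k) * qfact Q (N.+1 - k) =
    qfact Q (2 * N) * Q ^+ (N - k).+1 * (1 - Q ^+ (N + k)) * (1 - Q ^+ (N + k).+1).
  case: k lekN' {lekN here} => [|j] ltjN.
    by rewrite -!mulrA (mulrA (jcoef _ _ _)) next // !(subn0, addn0); ring.
  rewrite -(IHN j) ?(ltnW ltjN) // subSS -subSn // subSS.
  by rewrite (_ : (N.+1 + j.+1 = (N + j).+2)%N) ?addnS ?qfactS; [ring | lia].
rewrite [jcoef Q N.+1 k]/=; set T2 := (X in _ + X + _) in prev *.
transitivity ((1 + Q ^+ (2 * N + 1)) *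
    (jcoef Q N k * qfact Q (N.+1 + k) * qfact Q (N.+1 - k))
  + T2 * qfact Q (N.+1 + k) * qfact Q (N.+1 - k)
  + Q ^+ (N + k + 1) *
    (jcoef Q N k.+1 * qfact Q (N.+1 + k) * qfact Q (N.+1 - k))); first by ring.
rewrite here prev next //.
have QN : Q ^+ N = Q ^+ (N - k) * Q ^+ k by rewrite -exprD subnK.
rewrite expr_double1 !exprS !expr_double !exprD expr1 QN.
by set r := Q ^+ (N - k); set t := Q ^+ k; ring.
Qed.

End FiniteTripleProduct.

Definition theta_half e a b := infsum (fun k =>
  'q ^+ (a * 'C(k.+2, 2) + b * 'C(k.+1, 2)) * sign e ^+ k.+1).

(** Ramanujan's theta function f(q^a, q^b), or f(-q^a, -q^b) if e holds: the sum of
    (-1)^(e k) q^(a k(k+1)/2 + b k(k-1)/2) over all integers k. The two halves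
    carry the positive and the negative k. *)
HB.lock Definition theta e a b : qseries :=
  1 + (theta_half e a b + theta_half e b a).

Lemma leq_bin2 k : (k <= 'C(k.+1, 2))%N.
Proof. by rewrite binS bin1 leq_addl. Qed.

Lemma theta_half_summable e a b : (0 < a)%N -> summable (fun k =>
  'q ^+ (a * 'C(k.+2, 2) + b * 'C(k.+1, 2)) * sign e ^+ k.+1).
Proof.
move=> a0 k; apply: agreeXn0; have := leq_bin2 k.+1.
by set c := 'C(_, _); set c' := 'C(_, _); nia.
Qed.

(** Multiply the finite identity for x = (-1)^e q^a and y = (-1)^e q^b by the
    product (q^m; q^m), where m = a + b. The coefficient of index k becomes 1
    modulo q^(N-k+1), and it multiplies a monomial divisible by q^k, so that all
    terms agree with their limits modulo q^N. *)
Lemma triple_product e a b : (0 < a)%N -> (0 < b)%N ->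
  theta e a b = poch e a (a + b) * poch e b (a + b) * poch true (a + b) (a + b).
Proof.
move=> a0 b0; set m := (a + b)%N; have m0 : (0 < m)%N by rewrite addn_gt0 a0.
set f := poch true m m; have f0 : f 0%N = 1 := poch_coef0 _ _ _.
set x := 'q ^+ a * sign e; set y := 'q ^+ b * sign e.
have xy : x * y = 'q ^+ m by rewrite mulrACA sign_sq mulr1 -exprD.
have fM M : agree M.+1 (qfact ('q ^+ m) M) f.
  apply: agree_sym; rewrite /qfact.
  rewrite (eq_bigr (fun i : 'I_M => 1 + 'q ^+ (m * i + m) * sign true)).
    exact: (agree_infprod (poch_multipliable _ m0 m0)).
  by move=> i _; rewrite -exprM mulnS addnC /sign; ring.
have jf N k : (k <= N)%N -> agree (N - k).+1 (jcoef ('q ^+ m) N k * f) 1.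
  move=> lekN; apply: (agree_cancel f0); rewrite mulr1.
  apply: (@agree_trans _ (qfact ('q ^+ m) (2 * N))); last first.
    by apply: agree_le (fM _); lia.
  rewrite -(jcoef_qfact _ lekN) mulrCA (mulrC f) -mulrA.
  apply: agreeM => //; apply: agreeM; apply: agree_sym.
    by apply: agree_le (fM _); lia.
  exact: fM.
have jt u v N (k : 'I_N) (X Y : qseries) : (0 < u)%N -> 
    X = 'q ^+ u * sign e -> Y = 'q ^+ v * sign e ->
    agree N ('q ^+ (u * 'C(k.+2, 2) + v * 'C(k.+1, 2)) * sign e ^+ k.+1)
      (jcoef ('q ^+ m) N k.+1 * jterm X Y k.+1 * f).
  move=> u0 -> ->; rewrite mulrAC [X in agree _ _ X]mulrC.
  have -> : jterm ('q ^+ u * sign e) ('q ^+ v * sign e) k.+1 =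
      'q ^+ (u * 'C(k.+2, 2) + v * 'C(k.+1, 2)) * sign e ^+ k.+1.
    rewrite /jterm !exprMn -!(exprM 'q) exprD mulrACA; congr (_ * _).
    rewrite (binS k.+1 1) bin1 exprD mulrAC -exprMn sign_sq.
    by rewrite expr1n mul1r.
  rewrite -mulrA; apply: agreeXnM.
  rewrite -[X in agree _ X _]mulr1; apply: agreeM => //; apply: agree_sym.
  apply: agree_le (jf _ _ (ltn_ord k)); have := leq_bin2 k.+1.
  by set c := 'C(_, _); set c' := 'C(_, _); nia.
apply: agree_eq => N; apply: agree_sym.
apply: (@agree_trans _ ((\prod_(i < N) ((1 + x * (x * y) ^+ i) * (1 + y * (x * y) ^+ i))) * f)).
  rewrite big_split /=; apply: agreeM => //.
  apply: agreeM; apply: (@agree_le _ N.+1) => //.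
    rewrite (eq_bigr (fun i : 'I_N => 1 + 'q ^+ (m * i + a) * sign e)).
      exact: (agree_infprod (poch_multipliable _ a0 m0)).
    by move=> i _; rewrite xy /x -exprM exprD; ring.
  rewrite (eq_bigr (fun i : 'I_N => 1 + 'q ^+ (m * i + b) * sign e)).
    exact: (agree_infprod (poch_multipliable _ b0 m0)).
  by move=> i _; rewrite xy /y -exprM exprD; ring.
rewrite (finite_triple_product _ _ (leqnn N)) xy 2!mulrDl theta.unlock; apply: agreeD.
  by apply: agree_le (jf N 0%N _); rewrite ?subn0.
rewrite !mulr_suml; apply: agreeD; apply: agree_sym.
  apply: (agree_trans (agree_infsum (theta_half_summable e b a0))).
  by apply: agree_sum => k _; apply: jt.
apply: (agree_trans (agree_infsum (theta_half_summable e a b0))).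
by apply: agree_sum => k _; apply: jt.
Qed.

(** * Theta functions *)

(** (q; q). *)
Definition euler := poch true 1 1.
(** phi(-q), the sum of (-1)^k q^(k^2). *)
Definition phi_neg := theta true 1 1.
Definition phi := theta false 1 1.
Definition psi := infsum (fun k => 'q ^+ 'C(k.+1, 2)).
(** The sum of (-1)^k q^(3k^2 + 2k). *)
Definition omega := theta true 5 1.
(** The sum of q^(k(3k+1)/2), over the generalized pentagonal numbers. *)
Definition alpha := theta false 2 1.

Lemma double_bin2 k : (2 * 'C(k.+1, 2) = k * k.+1)%N.
Proof. by elim: k => // k IHk; rewrite binS bin1 mulnDr IHk; lia. Qed.

Lemma psi_summable : summable (fun k => 'q ^+ 'C(k.+1, 2)).
Proof.
by move=> k; rewrite -['q ^+ _]mulr1; apply: agreeXn0; apply: leq_bin2.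
Qed.

Lemma infsum_split2 s : summable s ->
  infsum s = infsum (fun k => s (2 * k)%N) + infsum (fun k => s (2 * k + 1)%N).
Proof.
move=> s0; rewrite (infsum_split (m := 2) _ s0) // !big_ord_recl big_ord0 addr0.
by congr (_ + _); apply: eq_infsum => k; rewrite addn0.
Qed.

Lemma infsum_split3 s : summable s ->
  infsum s = infsum (fun k => s (3 * k)%N) + infsum (fun k => s (3 * k + 1)%N)
             + infsum (fun k => s (3 * k + 2)%N).
Proof.
move=> s0; rewrite (infsum_split (m := 3) _ s0) // !big_ord_recl big_ord0 addr0 addrA.
by congr (_ + _ + _); apply: eq_infsum => k; rewrite addn0.
Qed.

(** The triangular numbers of index 2k and 2k - 1 are 2k^2 + k and 2k^2 - k. *)
Lemma psi_theta : psi = theta false 3 1.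
Proof.
rewrite /psi (infsum_recl psi_summable) theta.unlock expr0; congr (_ + _).
have s1 : summable (fun k => 'q ^+ 'C(k.+2, 2)).
  by move=> k; apply: (agree_le _ (@psi_summable k.+1)).
rewrite (infsum_split2 s1) addrC.
congr (_ + _); apply: eq_infsum => k; rewrite /sign expr0 expr1n mulr1.
  congr ('q ^+ _).
  have := double_bin2 (2 * k + 1).+1; have := double_bin2 k.+1.
  by have := double_bin2 k; nia.
congr ('q ^+ _).
have := double_bin2 (2 * k).+1; have := double_bin2 k.+1.
by have := double_bin2 k; nia.
Qed.

Lemma theta_coef0 e a b : (0 < a)%N -> (0 < b)%N -> theta e a b 0%N = 1.
Proof. by move=> a0 b0; rewrite triple_product // !qcoefM0 !poch_coef0. Qed.

Lemma dil_term d n e k : (0 < d)%N ->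
  dil d ('q ^+ n * sign e ^+ k) = 'q ^+ (d * n) * sign e ^+ k.
Proof.
move=> d0; rewrite dilM // [dil d ('q ^+ n)]dilX // [dil d (_ ^+ k)]dilX //.
by rewrite dil_q // dil_sign // exprM.
Qed.

Lemma dil_theta_half d e a b : (0 < d)%N -> (0 < a)%N ->
  dil d (theta_half e a b) = infsum (fun k =>
    'q ^+ (d * (a * 'C(k.+2, 2) + b * 'C(k.+1, 2))) * sign e ^+ k.+1).
Proof.
move=> d0 a0; rewrite infsum_dil //; last exact: theta_half_summable.
by apply: eq_infsum => k; rewrite dil_term.
Qed.

Lemma dil_theta d e a b : (0 < d)%N ->
  dil d (theta e a b) = 1 + (dil d (theta_half e a b) + dil d (theta_half e b a)).
Proof. by move=> d0; rewrite theta.unlock !dilD dil1. Qed.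

Lemma dil_psi d : (0 < d)%N -> dil d psi = infsum (fun k => 'q ^+ (d * 'C(k.+1, 2))).
Proof.
move=> d0; rewrite infsum_dil //; last exact: psi_summable.
by apply: eq_infsum => k; rewrite dilX // dil_q // exprM.
Qed.

Lemma psi_dil_summable d : (0 < d)%N -> summable (fun k => 'q ^+ (d * 'C(k.+1, 2))).
Proof.
move=> d0 k; rewrite -['q ^+ _]mulr1; apply: agreeXn0.
by have := leq_bin2 k; nia.
Qed.

(** An odd square is 1 + 8 T for a triangular number T, reached twice. *)
Lemma theta11_dissection e :
  theta e 1 1 = dil 4 phi + 2%:R * sign e * 'q * dil 8 psi.
Proof.
suff half : theta_half e 1 1 =
    dil 4 (theta_half false 1 1) + sign e * 'q * dil 8 psi.
  by rewrite /phi dil_theta // theta.unlock {1 2}half; ring.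
rewrite {1}/theta_half infsum_split2; last exact: theta_half_summable.
rewrite addrC dil_theta_half // dil_psi //.
rewrite -(infsumM (sign e * 'q) (psi_dil_summable (d := 8) _)) //.
congr (_ + _); apply: eq_infsum => k.
  have -> : sign e ^+ (2 * k + 1).+1 = 1.
    by rewrite (_ : (2 * k + 1).+1 = 2 * k.+1)%N ?exprM ?expr2 ?sign_sq ?expr1n //; lia.
  rewrite [sign false]/sign expr0 expr1n.
  congr ('q ^+ _ * _); have := double_bin2 (2 * k + 1).+1; have := double_bin2 k.+1.
  by have := double_bin2 k; have := double_bin2 (2 * k + 1); nia.
rewrite (exprS (sign e)) (exprM (sign e)) expr2 sign_sq expr1n mulr1 mulrC.
rewrite -mulrA -exprS; congr (_ * 'q ^+ _).
have := double_bin2 (2 * k).+1; have := double_bin2 k.+1.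
by have := double_bin2 k; have := double_bin2 (2 * k); nia.
Qed.

Lemma sign_eq i j : odd i = odd j -> sign true ^+ i = sign true ^+ j.
Proof. by move=> ij; rewrite /sign expr1 -(signr_odd _ i) ij signr_odd. Qed.

Lemma sign_neg i j : odd i = ~~ odd j -> sign true ^+ i = - sign true ^+ j.
Proof.
move=> ij; rewrite /sign expr1 -(signr_odd _ i) -(signr_odd _ j) ij.
by case: (odd j); rewrite ?expr1 ?expr0 ?opprK.
Qed.

(** The squares prime to 3 are the (3j+1)^2 = 1 + 3 (3j^2 + 2j) for all integers
    j, and each of them is reached twice, with the sign of -(-1)^j. *)
Lemma phi_neg_dissection : phi_neg = dil 9 phi_neg - 2%:R * 'q * dil 3 omega.
Proof.
suff half : theta_half true 1 1 = dil 9 (theta_half true 1 1) - 'q * dil 3 omega.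
  by rewrite /phi_neg dil_theta // theta.unlock {1 2}half; ring.
have sm := @theta_half_summable true 1 1 isT.
rewrite {1}/theta_half infsum_split3 //.
have s0 : summable (fun k => 'q ^+ (1 * 'C((3 * k).+2, 2) + 1 * 'C((3 * k).+1, 2))
    * sign true ^+ (3 * k).+1).
  by move=> k; apply: (agree_le _ (@sm (3 * k)%N)); lia.
rewrite (infsum_recl s0).
rewrite /omega dil_theta // !dil_theta_half //.
set S1 := infsum _; set S2 := infsum _; set S3 := infsum _.
set T1 := infsum _; set T2 := infsum _; set T3 := infsum _.
have -> : S3 = T1.
  apply: eq_infsum => k.
  rewrite (sign_eq (i := (3 * k + 2).+1) (j := k.+1)); last by lia.
  congr ('q ^+ _ * _); have := double_bin2 (3 * k + 2).+1.
  have := double_bin2 (3 * k + 2); have := double_bin2 k.+1.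
  by have := double_bin2 k; nia.
have -> : S2 = - 'q * T3.
  rewrite -infsumM; last first.
    move=> k; apply: agreeXn0; have := leq_bin2 k.+1.
    by set c := 'C(_, _); set c' := 'C(_, _); lia.
  apply: eq_infsum => k.
  rewrite (sign_neg (i := (3 * k + 1).+1) (j := k.+1)); last by lia.
  rewrite mulrN mulNr mulrA -exprS; congr (- ('q ^+ _ * _)).
  have := double_bin2 (3 * k + 1).+1; have := double_bin2 (3 * k + 1).
  by have := double_bin2 k.+1; have := double_bin2 k; nia.
have -> : S1 = - 'q * T2.
  rewrite -infsumM; last first.
    move=> k; apply: agreeXn0; have := leq_bin2 k.+1.
    by set c := 'C(_, _); set c' := 'C(_, _); lia.
  apply: eq_infsum => k.
  rewrite (sign_neg (i := (3 * k.+1).+1) (j := k.+1)); last by lia.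
  rewrite mulrN mulNr mulrA -exprS; congr (- ('q ^+ _ * _)).
  have := double_bin2 (3 * k.+1).+1; have := double_bin2 (3 * k.+1).
  by have := double_bin2 k.+1; have := double_bin2 k; nia.
have -> : 'q ^+ (1 * 'C((3 * 0).+2, 2) + 1 * 'C((3 * 0).+1, 2))
    * sign true ^+ (3 * 0).+1 = - 'q by rewrite -[LHS]/('q * -1) mulrN1.
by ring.
Qed.

(** The triangular number of index 3j + 1 is 1 + 9 j(j+1)/2; those of index 3j and
    3j + 2 are three times the generalized pentagonal numbers. *)
Lemma psi_dissection : psi = dil 3 alpha + 'q * dil 9 psi.
Proof.
rewrite {1}/psi (infsum_split3 psi_summable).
have s0 : summable (fun k => 'q ^+ 'C((3 * k).+1, 2)).
  by move=> k; apply: (agree_le _ (@psi_summable (3 * k)%N)); lia.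
rewrite (infsum_recl s0).
rewrite /alpha dil_theta // !dil_theta_half // dil_psi //.
rewrite -(infsumM 'q (psi_dil_summable (d := 9) _)) //.
set S1 := infsum _; set S2 := infsum _; set S3 := infsum _.
set T1 := infsum _; set T2 := infsum _; set T3 := infsum _.
have -> : S1 = T1.
  apply: eq_infsum => k; rewrite /sign expr0 expr1n mulr1; congr ('q ^+ _).
  have := double_bin2 (3 * k.+1).
  by have := double_bin2 k.+1; have := double_bin2 k; nia.
have -> : S2 = T3.
  apply: eq_infsum => k; rewrite -exprS; congr ('q ^+ _).
  by have := double_bin2 (3 * k + 1); have := double_bin2 k; nia.
have -> : S3 = T2.
  apply: eq_infsum => k; rewrite /sign expr0 expr1n mulr1; congr ('q ^+ _).
  have := double_bin2 (3 * k + 2).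
  by have := double_bin2 k.+1; have := double_bin2 k; nia.
by rewrite -['q ^+ 'C((3 * 0).+1, 2)]/(1 : qseries); ring.
Qed.

(** The theta functions are quotients of the products (q^d; q^d). The formulas
    are stated with cleared denominators. *)


Lemma euler_odd : poch true 1 2 * dil 2 euler = euler.
Proof.
by rewrite [RHS](poch_split (m := 2)) // !big_ord_recl big_ord0 mulr1 poch_dil.
Qed.

Lemma plus_odd : poch false 1 2 * dil 2 (poch false 1 1) = poch false 1 1.
Proof.
by rewrite [RHS](poch_split (m := 2)) // !big_ord_recl big_ord0 mulr1 poch_dil.
Qed.

Lemma phi_neg_product : phi_neg * dil 2 euler = euler ^+ 2.
Proof.
rewrite /phi_neg triple_product //= -[in RHS]euler_odd.
by rewrite (_ : poch true (1 + 1) (1 + 1) = dil 2 euler) ?poch_dil //; ring.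
Qed.

Lemma psi_product : psi * euler = dil 2 euler ^+ 2.
Proof.
rewrite psi_theta triple_product //= -[poch true _ _]/(poch true (2 * 2) (2 * 2)).
have -> : poch false 3 (3 + 1) * poch false 1 (3 + 1) = poch false 1 2.
  by rewrite [RHS](poch_split (m := 2)) // !big_ord_recl big_ord0 mulr1 mulrC.
rewrite -poch_dil // -[poch true 2 2]/(poch true (2 * 1) (2 * 1)) -poch_dil //.
rewrite -poch_plus_minus dilM // -/euler mulrA plus_odd.
by rewrite mulrAC poch_plus_minus -/euler; ring.
Qed.

Lemma alpha_product : alpha * euler * dil 6 euler = dil 2 euler * dil 3 euler ^+ 2.
Proof.
have h3 : dil 3 (poch false 1 1) * dil 3 euler = dil 6 euler.
  by rewrite -dilM // poch_plus_minus dil_dil.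
have a3 : alpha * dil 3 (poch false 1 1) = poch false 1 1 * dil 3 euler.
  rewrite [poch false 1 1 in RHS](poch_split (m := 3)) // !big_ord_recl big_ord0.
  by rewrite /alpha triple_product // !poch_dil //=; ring.
rewrite -h3 -poch_plus_minus -/euler.
transitivity (alpha * dil 3 (poch false 1 1) * euler * dil 3 euler); first by ring.
by rewrite a3; ring.
Qed.

Lemma omega_product : omega * dil 2 euler * dil 3 euler = euler * dil 6 euler ^+ 2.
Proof.
have g3 : dil 3 (poch true 1 2) * dil 6 euler = dil 3 euler.
  by rewrite -{2}euler_odd dilM // dil_dil.
have o3 : omega * dil 3 (poch true 1 2) = poch true 1 2 * dil 6 euler.
  rewrite [poch true 1 2 in RHS](poch_split (m := 3)) // !big_ord_recl big_ord0.
  by rewrite /omega triple_product // !poch_dil //=; ring.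
rewrite -g3 -[X in _ = X * _]euler_odd.
transitivity (omega * dil 3 (poch true 1 2) * dil 2 euler * dil 6 euler); first by ring.
by rewrite o3; ring.
Qed.

(** * Norms *)

Lemma dil0 d : dil d 0 = 0.
Proof. by apply: qseriesP => n /=; case: ifP. Qed.

Lemma sec_dissection2 A B : let F := dil 2 A + 'q * dil 2 B in
  sec 2 0 F = A /\ sec 2 1 F = B.
Proof.
have e0 : dil 2 A = 'q ^+ (2 * 0 + 0) * dil 2 A by rewrite mul1r.
have e1 : 'q * dil 2 B = 'q ^+ (2 * 0 + 1) * dil 2 B by [].
by rewrite /= e0 e1 !secD !sec_qdil //= !mul1r ?addr0 ?add0r.
Qed.

Lemma sec_dissection3 A B C : let F := dil 3 A + 'q * dil 3 B + 'q ^+ 2 * dil 3 C in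
  [/\ sec 3 0 F = A, sec 3 1 F = B & sec 3 2 F = C].
Proof.
have e0 : dil 3 A = 'q ^+ (3 * 0 + 0) * dil 3 A by rewrite mul1r.
have e1 : 'q * dil 3 B = 'q ^+ (3 * 0 + 1) * dil 3 B by [].
have e2 : 'q ^+ 2 * dil 3 C = 'q ^+ (3 * 0 + 2) * dil 3 C by [].
by rewrite /= e0 e1 e2 !secD !sec_qdil //= !mul1r ?addr0 ?add0r.
Qed.

Lemma dissection2 F : F = dil 2 (sec 2 0 F) + 'q * dil 2 (sec 2 1 F).
Proof.
have [s0 s1] := sec_dissection2 (sec 2 0 F) (sec 2 1 F).
by apply: (sec_eq (d := 2)) => // [[|[|[]]]].
Qed.

Lemma dissection3 F :
  F = dil 3 (sec 3 0 F) + 'q * dil 3 (sec 3 1 F) + 'q ^+ 2 * dil 3 (sec 3 2 F).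
Proof.
have [s0 s1 s2] := sec_dissection3 (sec 3 0 F) (sec 3 1 F) (sec 3 2 F).
by apply: (sec_eq (d := 3)) => // [[|[|[|[]]]]].
Qed.

(** The product F(q) F(-q), which is a series in q^2, taken at q^(1/2). *)
Definition norm2 F := sec 2 0 F ^+ 2 - 'q * sec 2 1 F ^+ 2.
(** The product F(q) F(wq) F(w^2 q), where w is a primitive cube root of unity, is a
    series in q^3; this is its value at q^(1/3), written as the circulant
    determinant of the sections of F so that the coefficients stay integers. *)
Definition norm3 F := let A := sec 3 0 F in let B := sec 3 1 F in
  let C := sec 3 2 F in
  A ^+ 3 + 'q * B ^+ 3 + 'q ^+ 2 * C ^+ 3 - 3%:R * 'q * A * B * C.

Lemma norm2E A B : norm2 (dil 2 A + 'q * dil 2 B) = A ^+ 2 - 'q * B ^+ 2.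
Proof. by rewrite /norm2; have /= [-> ->] := sec_dissection2 A B. Qed.

Lemma norm3E A B C : norm3 (dil 3 A + 'q * dil 3 B + 'q ^+ 2 * dil 3 C) =
  A ^+ 3 + 'q * B ^+ 3 + 'q ^+ 2 * C ^+ 3 - 3%:R * 'q * A * B * C.
Proof. by rewrite /norm3; have /= [-> -> ->] := sec_dissection3 A B C. Qed.

Lemma norm2M F G : norm2 (F * G) = norm2 F * norm2 G.
Proof.
rewrite (dissection2 F) (dissection2 G).
set A := sec 2 0 F; set B := sec 2 1 F; set A' := sec 2 0 G; set B' := sec 2 1 G.
have -> : (dil 2 A + 'q * dil 2 B) * (dil 2 A' + 'q * dil 2 B') =
    dil 2 (A * A' + 'q * (B * B')) + 'q * dil 2 (A * B' + B * A').
  by rewrite !(dil_q, dilM, dilD) //; ring.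
by rewrite !norm2E; ring.
Qed.

Lemma norm3M F G : norm3 (F * G) = norm3 F * norm3 G.
Proof.
rewrite (dissection3 F) (dissection3 G).
set A := sec 3 0 F; set B := sec 3 1 F; set C := sec 3 2 F.
set A' := sec 3 0 G; set B' := sec 3 1 G; set C' := sec 3 2 G.
have -> : (dil 3 A + 'q * dil 3 B + 'q ^+ 2 * dil 3 C)
    * (dil 3 A' + 'q * dil 3 B' + 'q ^+ 2 * dil 3 C') =
    dil 3 (A * A' + 'q * (B * C' + C * B'))
    + 'q * dil 3 (A * B' + B * A' + 'q * (C * C'))
    + 'q ^+ 2 * dil 3 (A * C' + B * B' + C * A').
  by rewrite !(dil_q, dilM, dilD) //; ring.
by rewrite !norm3E; ring.
Qed.

Lemma norm2_dil2 F : norm2 (dil 2 F) = F ^+ 2.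
Proof.
have -> : dil 2 F = dil 2 F + 'q * dil 2 0 by rewrite dil0 mulr0 addr0.
by rewrite norm2E; ring.
Qed.

Lemma norm3_dil3 F : norm3 (dil 3 F) = F ^+ 3.
Proof.
have -> : dil 3 F = dil 3 F + 'q * dil 3 0 + 'q ^+ 2 * dil 3 0.
  by rewrite dil0 !mulr0 !addr0.
by rewrite norm3E; ring.
Qed.

(** Doubling permutes the nonzero residues modulo 3. *)
Lemma norm3_dil2 F : norm3 (dil 2 F) = dil 2 (norm3 F).
Proof.
rewrite (dissection3 F).
set A := sec 3 0 F; set B := sec 3 1 F; set C := sec 3 2 F.
have -> : dil 2 (dil 3 A + 'q * dil 3 B + 'q ^+ 2 * dil 3 C) =
    dil 3 (dil 2 A) + 'q * dil 3 ('q * dil 2 C) + 'q ^+ 2 * dil 3 (dil 2 B).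
  by rewrite !(dil_q, dilX, dil_dil, dilM, dilD) //; ring.
by rewrite !norm3E !(dil_nat, dil_q, dilX, dilN, dilM, dilD) //; ring.
Qed.

Lemma agree_norm2 N F G : agree (2 * N) F G -> agree N (norm2 F) (norm2 G).
Proof.
move=> FG; have FGr r : (r < 2)%N -> agree N (sec 2 r F) (sec 2 r G).
  by move=> r2; apply: agree_sec.
have [F0 F1] := (FGr 0%N isT, FGr 1%N isT).
by apply: agreeD; [|apply: agreeN; apply: agreeM => //]; rewrite !expr2; apply: agreeM.
Qed.

Lemma agree_norm3 N F G : agree (3 * N) F G -> agree N (norm3 F) (norm3 G).
Proof.
move=> FG; have FGr r : (r < 3)%N -> agree N (sec 3 r F) (sec 3 r G).
  by move=> r2; apply: agree_sec.
have F0 := FGr 0%N isT; have F1 := FGr 1%N isT; have F2 := FGr 2%N isT.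
rewrite /norm3 /=; apply: agreeD; last by apply: agreeN; do 3?apply: agreeM.
by rewrite !exprS !expr0; do ?apply: agreeD; do ?apply: agreeM.
Qed.

(** Modulo q^N, a norm only depends on the series modulo q^(d N), so that it can be
    computed factor by factor on an infinite product. *)
Lemma norm_infprod d (norm : qseries -> qseries) s : (0 < d)%N ->
  norm 1 = 1 -> (forall F G, norm (F * G) = norm F * norm G) ->
  (forall N F G, agree (d * N) F G -> agree N (norm F) (norm G)) ->
  multipliable s -> multipliable (norm \o s) ->
  norm (infprod s) = infprod (norm \o s).
Proof.
move=> d0 n1 nM nC s1 ns1; apply: agree_eq => N.
apply: (@agree_trans _ (norm (\prod_(k < d * N) s k))).
  by apply: nC; apply: (agree_le _ (agree_infprod s1)).
rewrite (big_morph norm nM n1); apply: agree_sym.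
by apply: (agree_le _ (agree_infprod ns1)); nia.
Qed.

Lemma norm_poch d (norm : qseries -> qseries) a : (0 < d)%N -> (0 < a)%N ->
  norm 1 = 1 -> (forall F G, norm (F * G) = norm F * norm G) ->
  (forall N F G, agree (d * N) F G -> agree N (norm F) (norm G)) ->
  (forall k, norm (1 + 'q ^+ (d * k + a) * sign true) =
             1 + 'q ^+ (d * k + a) * sign true) ->
  norm (poch true a d) = poch true a d.
Proof.
move=> d0 a0 n1 nM nC nk; rewrite /poch (norm_infprod (d := d)) //.
- by apply: eq_infprod => k; apply: nk.
- exact: poch_multipliable.
by move=> k /=; rewrite nk; apply: (poch_multipliable true).
Qed.

Lemma exprD_mul F d k r : F ^+ (d * k + r) = F ^+ r * (F ^+ k) ^+ d.
Proof. by rewrite exprD mulnC exprM mulrC. Qed.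

(** The norm of 1 - q^n is 1 - q^n if n is odd, and (1 - q^(n/2))^2 if n is even. *)
Lemma norm2_euler : norm2 euler * dil 2 euler = euler ^+ 3.
Proof.
suff odd : norm2 (poch true 1 2) = poch true 1 2.
  rewrite -{1}euler_odd norm2M norm2_dil2 odd mulrAC euler_odd.
  by rewrite -exprS.
have n1 : norm2 1 = 1 by rewrite -{1}(dil1 (d := 2)) // norm2_dil2 expr1n.
apply: (norm_poch (d := 2)) => //; [exact: norm2M | exact: agree_norm2 | move=> k].
rewrite [X in norm2 X](_ : _ = dil 2 1 + 'q * dil 2 (- 'q ^+ k)); last first.
  by rewrite dil1 // dilN dilX // dil_q // exprD_mul -!exprM (mulnC k) /sign; ring.
by rewrite norm2E exprD_mul /sign; ring.
Qed.

(** The norm of 1 - q^n is (1 - q^(n/3))^3 if 3 divides n, and 1 - q^n otherwise. *)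
Lemma norm3_euler : norm3 euler * dil 3 euler = euler ^+ 4.
Proof.
have n1 : norm3 1 = 1 by rewrite -{1}(dil1 (d := 3)) // norm3_dil3 expr1n.
have p1 : norm3 (poch true 1 3) = poch true 1 3.
  apply: (norm_poch (d := 3)) => //; [exact: norm3M | exact: agree_norm3 | move=> k].
  rewrite [X in norm3 X](_ : _ = dil 3 1 + 'q * dil 3 (- 'q ^+ k) + 'q ^+ 2 * dil 3 0); last first.
    by rewrite dil0 dil1 // dilN dilX // dil_q // exprD_mul -!exprM (mulnC k) /sign; ring.
  by rewrite norm3E exprD_mul /sign; ring.
have p2 : norm3 (poch true 2 3) = poch true 2 3.
  apply: (norm_poch (d := 3)) => //; [exact: norm3M | exact: agree_norm3 | move=> k].
  rewrite [X in norm3 X](_ : _ = dil 3 1 + 'q * dil 3 0 + 'q ^+ 2 * dil 3 (- 'q ^+ k)); last first.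
    by rewrite dil0 dil1 // dilN dilX // dil_q // exprD_mul -!exprM (mulnC k) /sign; ring.
  by rewrite norm3E exprD_mul /sign; ring.
have euler3 : euler = poch true 1 3 * poch true 2 3 * dil 3 euler.
  rewrite [LHS](poch_split (m := 3)) // !big_ord_recl big_ord0 poch_dil //=.
  by ring.
rewrite {1}euler3 !norm3M p1 p2 norm3_dil3 mulrAC -euler3.
by rewrite -exprS.
Qed.

(** * Identities of levels 2 and 4 *)

Lemma coef0_1_mul F G : F 0%N = 1 -> G 0%N = 1 -> (F * G) 0%N = 1.
Proof. by move=> F0 G0; rewrite qcoefM0 F0 G0. Qed.

Lemma coef0_1_exp F k : F 0%N = 1 -> (F ^+ k) 0%N = 1.
Proof. by move=> F0; rewrite qcoefX0 F0 expr1n. Qed.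

Lemma coef0_1_dil d F : F 0%N = 1 -> dil d F 0%N = 1.
Proof. by rewrite dil_coef0. Qed.

Lemma psi_coef0 : psi 0%N = 1.
Proof. by rewrite psi_theta theta_coef0. Qed.

Ltac coef0_1 := repeat first
  [ exact: poch_coef0 | exact: theta_coef0 | exact: psi_coef0
  | apply: coef0_1_exp | apply: coef0_1_dil | apply: coef0_1_mul ].

Lemma norm2_phi_neg : norm2 phi_neg = phi_neg ^+ 2.
Proof.
have := congr1 norm2 phi_neg_product; rewrite expr2 !norm2M norm2_dil2 => nphi.
apply: (@mulI_coef0_1 (euler ^+ 2 * dil 2 euler ^+ 2)); first coef0_1.
transitivity (norm2 phi_neg * euler ^+ 2 * dil 2 euler ^+ 2); first by ring.
rewrite nphi.
transitivity ((norm2 euler * dil 2 euler) ^+ 2); first by ring.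
rewrite norm2_euler.
transitivity (euler ^+ 2 * (phi_neg * dil 2 euler) ^+ 2); last by ring.
by rewrite phi_neg_product; ring.
Qed.

Lemma phi_dissection : phi = dil 4 phi + 2%:R * 'q * dil 8 psi.
Proof. by rewrite {1}/phi theta11_dissection /sign expr0 mulr1. Qed.

Lemma phi_neg_dissection2 : phi_neg = dil 4 phi - 2%:R * 'q * dil 8 psi.
Proof. by rewrite /phi_neg theta11_dissection /sign expr1; ring. Qed.

(** The norm of phi(-q) is known from its product (norm2_phi_neg); here it is
    computed from the dissection. *)
Lemma phi_neg_sq : phi_neg ^+ 2 = dil 2 phi ^+ 2 - 4%:R * 'q * dil 4 psi ^+ 2.
Proof.
have -> : phi_neg ^+ 2 = norm2 phi_neg by rewrite norm2_phi_neg.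
have -> : phi_neg = dil 2 (dil 2 phi) + 'q * dil 2 (- (2%:R * dil 4 psi)).
  by rewrite dilN dilM // dil_nat // !dil_dil // phi_neg_dissection2; ring.
by rewrite norm2E; ring.
Qed.

(** Both sides are the norm of phi(-q), at q^2. *)
Lemma phi_phi_neg : phi * phi_neg = dil 2 (phi_neg ^+ 2).
Proof.
rewrite phi_neg_sq {1}phi_dissection phi_neg_dissection2.
by rewrite !(dil_nat, dil_q, dilX, dil_dil, dilN, dilM, dilD) //; ring.
Qed.

Lemma phi_psi : phi * dil 2 psi = psi ^+ 2.
Proof.
apply: (@mulI_coef0_1 phi_neg); first by rewrite theta_coef0.
have d4 : dil 2 phi_neg * dil 4 euler = dil 2 euler ^+ 2.
  by rewrite -(dil_dil (d := 2) (e := 2)) // -dilM // phi_neg_product dilX.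
have p4 : dil 2 psi * dil 2 euler = dil 4 euler ^+ 2.
  by rewrite -dilM // psi_product dilX // dil_dil.
transitivity (phi * phi_neg * dil 2 psi); first by ring.
rewrite phi_phi_neg dilX //.
transitivity (dil 2 euler ^+ 3).
  apply: (@mulI_coef0_1 (dil 4 euler ^+ 2 * dil 2 euler)); first coef0_1.
  by ring: d4 p4.
apply: (@mulI_coef0_1 (euler ^+ 2 * dil 2 euler)); first coef0_1.
by ring: phi_neg_product psi_product.
Qed.

(** The Eisenstein series 1 + 24 (the sum over n > 0 of q^n times the sum of the
    odd divisors of n). By phi_pow4 it is the even part of phi^4 at q^(1/2). *)
Definition eis := phi ^+ 4 + 16%:R * 'q * dil 2 psi ^+ 4.

Lemma phi_sq : phi ^+ 2 = dil 2 phi ^+ 2 + 4%:R * 'q * dil 4 psi ^+ 2.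
Proof.
have p4 : dil 4 phi * dil 8 psi = dil 4 psi ^+ 2.
  by rewrite -(dil_dil (d := 4) (e := 2)) // -dilM // phi_psi dilX.
have -> : phi ^+ 2 = phi_neg ^+ 2 + 8%:R * 'q * (dil 4 phi * dil 8 psi).
  by rewrite {1}phi_dissection phi_neg_dissection2; ring.
by rewrite p4 phi_neg_sq; ring.
Qed.

(** In the square of phi_sq, the cross term is a single product by phi_psi. *)
Lemma phi_pow4 : phi ^+ 4 = dil 2 eis + 8%:R * 'q * dil 2 psi ^+ 4.
Proof.
have p2 : dil 2 phi * dil 4 psi = dil 2 psi ^+ 2.
  by rewrite -(dil_dil (d := 2) (e := 2)) // -dilM // phi_psi dilX.
rewrite /eis !(dil_nat, dil_q, dilX, dil_dil, dilM, dilD) // -[(2 * 2)%N]/4%N.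
have -> : phi ^+ 4 = (phi ^+ 2) ^+ 2 by ring.
rewrite phi_sq.
transitivity (dil 2 phi ^+ 4 + 16%:R * 'q ^+ 2 * dil 4 psi ^+ 4
  + 8%:R * 'q * (dil 2 phi * dil 4 psi) ^+ 2); first by ring.
by rewrite p2; ring.
Qed.

Lemma phi_neg_pow4 : phi_neg ^+ 4 = dil 2 eis - 8%:R * 'q * dil 2 psi ^+ 4.
Proof.
have p2 : dil 2 phi * dil 4 psi = dil 2 psi ^+ 2.
  by rewrite -(dil_dil (d := 2) (e := 2)) // -dilM // phi_psi dilX.
have <- : phi ^+ 4 - 16%:R * 'q * dil 2 psi ^+ 4
    = dil 2 eis - 8%:R * 'q * dil 2 psi ^+ 4 by rewrite phi_pow4; ring.
have -> : phi_neg ^+ 4 = (phi_neg ^+ 2) ^+ 2 by ring.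
have -> : phi ^+ 4 = (phi ^+ 2) ^+ 2 by ring.
have -> : dil 2 psi ^+ 4 = (dil 2 psi ^+ 2) ^+ 2 by ring.
by rewrite phi_neg_sq phi_sq -p2; ring.
Qed.

(** The product phi(q)^4 phi(-q)^4 is a difference of squares by phi_pow4 and
    phi_neg_pow4, and it is phi(-q^2)^8 by phi_phi_neg: this is the identity at
    q^2. *)
Lemma eis_sq : eis ^+ 2 = phi_neg ^+ 8 + 64%:R * 'q * psi ^+ 8.
Proof.
apply: (dil_inj (d := 2)) => //.
have -> : dil 2 (phi_neg ^+ 8 + 64%:R * 'q * psi ^+ 8) =
    dil 2 (phi_neg ^+ 2) ^+ 4 + 64%:R * 'q ^+ 2 * dil 2 psi ^+ 8.
  by rewrite !(dil_nat, dil_q, dilX, dilM, dilD) //; ring.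
rewrite -phi_phi_neg exprMn phi_pow4 phi_neg_pow4 dilX //.
by ring.
Qed.

(** * Identities of level 6 *)

Lemma norm3_phi_neg : norm3 phi_neg = dil 3 phi_neg ^+ 3 - 8%:R * 'q * omega ^+ 3.
Proof.
have {1}-> : phi_neg = dil 3 (dil 3 phi_neg) + 'q * dil 3 (- (2%:R * omega))
    + 'q ^+ 2 * dil 3 0.
  rewrite dil0 dilN dilM // dil_nat // dil_dil // {1}phi_neg_dissection.
  by ring.
by rewrite norm3E; ring.
Qed.

Lemma norm3_psi : norm3 psi = alpha ^+ 3 + 'q * dil 3 psi ^+ 3.
Proof.
have {1}-> : psi = dil 3 alpha + 'q * dil 3 (dil 3 psi) + 'q ^+ 2 * dil 3 0.
  by rewrite dil0 dil_dil // {1}psi_dissection; ring.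
by rewrite norm3E; ring.
Qed.

Lemma norm3_euler2 : norm3 (dil 2 euler) * dil 6 euler = dil 2 euler ^+ 4.
Proof.
rewrite norm3_dil2 -(dil_dil (d := 2) (e := 3)) // -dilM // norm3_euler.
by rewrite dilX.
Qed.

Lemma phi_neg_product3 : dil 3 phi_neg * dil 6 euler = dil 3 euler ^+ 2.
Proof. by rewrite -(dil_dil (d := 3) (e := 2)) // -dilM // phi_neg_product dilX. Qed.

Lemma psi_product3 : dil 3 psi * dil 3 euler = dil 6 euler ^+ 2.
Proof. by rewrite -dilM // psi_product dilX // dil_dil. Qed.

(** The norm of phi(-q) computed from its product; norm3_phi_neg computes it from
    the dissection. *)
Lemma cubic_phi :
  dil 3 phi_neg * (dil 3 phi_neg ^+ 3 - 8%:R * 'q * omega ^+ 3) = phi_neg ^+ 4.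
Proof.
rewrite -norm3_phi_neg.
have := congr1 norm3 phi_neg_product; rewrite expr2 !norm3M => nphi.
apply: (@mulI_coef0_1 (dil 2 euler ^+ 4 * dil 3 euler ^+ 2 * dil 6 euler)).
  coef0_1.
transitivity ((norm3 phi_neg * norm3 (dil 2 euler)) * dil 3 euler ^+ 2
    * (dil 3 phi_neg * dil 6 euler) * dil 6 euler).
  by rewrite -norm3_euler2; ring.
rewrite nphi phi_neg_product3.
transitivity ((norm3 euler * dil 3 euler) ^+ 2 * dil 3 euler ^+ 2 * dil 6 euler).
  by ring.
rewrite norm3_euler.
transitivity ((phi_neg * dil 2 euler) ^+ 4 * dil 3 euler ^+ 2 * dil 6 euler).
  by rewrite phi_neg_product; ring.
by ring.
Qed.

(** The same comparison for the norm of psi. *)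
Lemma cubic_psi :
  dil 3 psi * (alpha ^+ 3 + 'q * dil 3 psi ^+ 3) = psi ^+ 4.
Proof.
rewrite -norm3_psi.
have := congr1 norm3 psi_product; rewrite expr2 !norm3M => npsi.
apply: (@mulI_coef0_1 (euler ^+ 4 * dil 6 euler ^+ 2 * dil 3 euler)).
  coef0_1.
transitivity ((norm3 psi * norm3 euler) * dil 6 euler ^+ 2
    * (dil 3 psi * dil 3 euler) * dil 3 euler).
  by rewrite -norm3_euler; ring.
rewrite npsi psi_product3.
transitivity ((norm3 (dil 2 euler) * dil 6 euler) ^+ 2 * dil 6 euler ^+ 2 * dil 3 euler).
  by ring.
rewrite norm3_euler2.
transitivity ((psi * euler) ^+ 4 * dil 6 euler ^+ 2 * dil 3 euler).
  by rewrite psi_product; ring.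
by ring.
Qed.

Lemma alpha_omega : alpha * omega = dil 3 psi * dil 3 phi_neg.
Proof.
apply: (@mulI_coef0_1 (euler * dil 2 euler * dil 3 euler * dil 6 euler)).
  coef0_1.
transitivity ((alpha * euler * dil 6 euler) * (omega * dil 2 euler * dil 3 euler)).
  by ring.
rewrite alpha_product omega_product.
transitivity (euler * dil 2 euler * (dil 3 psi * dil 3 euler)
  * (dil 3 phi_neg * dil 6 euler)); last by ring.
by rewrite psi_product3 phi_neg_product3; ring.
Qed.

(** Multiply by alpha^3 psi(q^3) phi(-q^3). On the left, cubic_phi applies. On the
    right, alpha_omega turns alpha^3 (phi(-q^3)^3 + q omega^3) into
    phi(-q^3)^3 (alpha^3 + q psi(q^3)^3), to which cubic_psi applies. What remains
    is an identity between quotients of products (q^d; q^d). *)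
Lemma level6_ratio : alpha ^+ 8 * (dil 3 phi_neg ^+ 3 - 8%:R * 'q * omega ^+ 3) =
  omega * dil 3 phi_neg ^+ 7 * (dil 3 phi_neg ^+ 3 + 'q * omega ^+ 3).
Proof.
have prod : alpha ^+ 11 * dil 3 psi * phi_neg ^+ 4 =
    omega * dil 3 phi_neg ^+ 11 * psi ^+ 4.
  apply: (@mulI_coef0_1 (euler ^+ 15 * dil 2 euler ^+ 5 * dil 3 euler ^+ 2 * dil 6 euler ^+ 22)).
    coef0_1.
  transitivity ((alpha * euler * dil 6 euler) ^+ 11 * (dil 3 psi * dil 3 euler)
      * (phi_neg * dil 2 euler) ^+ 4
      * (euler ^+ 4 * dil 2 euler * dil 3 euler * dil 6 euler ^+ 11)); first by ring.
  transitivity ((omega * dil 2 euler * dil 3 euler)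
      * (dil 3 phi_neg * dil 6 euler) ^+ 11 * (psi * euler) ^+ 4
      * (euler ^+ 11 * dil 2 euler ^+ 4 * dil 3 euler * dil 6 euler ^+ 11)); last by ring.
  rewrite alpha_product omega_product psi_product3 phi_neg_product3 psi_product.
  by rewrite phi_neg_product; ring.
apply: (@mulI_coef0_1 (alpha ^+ 3 * dil 3 psi * dil 3 phi_neg)).
  coef0_1.
transitivity (alpha ^+ 11 * dil 3 psi *
  (dil 3 phi_neg * (dil 3 phi_neg ^+ 3 - 8%:R * 'q * omega ^+ 3))); first by ring.
rewrite cubic_phi prod -cubic_psi.
transitivity (omega * dil 3 phi_neg ^+ 8 * dil 3 psi
  * (dil 3 phi_neg ^+ 3 * alpha ^+ 3 + 'q * (alpha * omega) ^+ 3)); last by ring.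
by rewrite alpha_omega; ring.
Qed.

(** * The generating function of overpartitions *)

(** The flag b tells whether the part m may be overlined. *)
Definition bounded_overpartition m b n (s : seq (nat * bool)) :=
  [&& is_overpartition n s, all (fun x => x.1 <= m)%N s & b || ((m, true) \notin s)].

(** After a first part equal to the bound, an overlined part of that size is no
    longer possible; this is why the flag becomes false. *)
Lemma bounded_overpartition_cons m b n p c s :
  bounded_overpartition m.+1 b n ((p, c) :: s) =
  if p == m.+1 then
    [&& m.+1 <= n, c ==> b & bounded_overpartition m.+1 false (n - m.+1) s]%N
  else bounded_overpartition m true n ((p, c) :: s).
Proof.
have trans_geq : transitive geq by move=> x y z /= yx zy; apply: leq_trans yx.
have path_all : path geq p (unzip1 s) -> all (fun x => x.1 <= p)%N s.
  by rewrite (path_sortedE trans_geq) all_map => /andP[].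
rewrite /bounded_overpartition /is_overpartition /=.
have [pE|pm] := eqVneq p m.+1; last first.
  case: (boolP (path geq p (unzip1 s))) => [/path_all sp|]; last by rewrite !andbF.
  have -> : (p <= m.+1)%N = (p <= m)%N by rewrite leq_eqVlt (negPf pm).
  case: (leqP p m) => [lepm|]; rewrite ?andbF //= !andbT.
  have sm k : (m <= k)%N -> all (fun x : nat * bool => x.1 <= k)%N s.
    by move=> lemk; apply: sub_all sp => x /leq_trans -> //; apply: leq_trans lemk.
  rewrite !sm // (_ : (m.+1, true) \notin _) ?orbT ?andbT //.
  rewrite inE negb_or; apply/andP; split.
    by apply: contra pm => /eqP[<-].
  by apply/negP => /(allP (sm m (leqnn m))); rewrite /= ltnn.
rewrite {}pE {path_all} leqnn (path_sortedE trans_geq) all_map /=.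
have -> : all (fun y : nat * bool => (m.+1 == y.1) ==> ~~ y.2) s = ((m.+1, true) \notin s).
  rewrite -has_pred1 -all_predC; apply: eq_all => [[x d]] /=.
  by rewrite eq_sym -pair_eqE /pair_eq /=; case: d; rewrite ?andbT ?andbF ?implybF ?implybT.
have -> : (m.+1 + sumn (unzip1 s) == n)%N =
    (m.+1 <= n)%N && (sumn (unzip1 s) == n - m.+1)%N.
  by apply/eqP/andP => [<-|[lemn /eqP ->]]; [rewrite leq_addr addKn | rewrite subnKC].
rewrite inE negb_or xpair_eqE eqxx /=.
have -> : all (geq m.+1) (unzip1 s) = all (fun x => x.1 <= m.+1)%N s by rewrite all_map.
set x1 := all _ _; set x2 := all _ _; set x3 := sorted _ _; set x4 := (_ == _).
set x5 := (_ <= _)%N; set x6 := pairwise _ _; set x7 := (_ \notin _).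
by case: b; case: c; case: x1; case: x2; case: x3; case: x4; case: x5; case: x6; case: x7.
Qed.

Lemma bounded_overpartition_nil m b n :
  bounded_overpartition m b n [::] = (n == 0%N).
Proof. by rewrite /bounded_overpartition /is_overpartition /= orbT !andbT eq_sym. Qed.

(** The depth k of the recursion is sufficient when k >= m + n, as each step
    lowers m or n. *)
Fixpoint overpartitions (k m : nat) (b : bool) (n : nat) : seq (seq (nat * bool)) :=
  match k, m with
  | k'.+1, m'.+1 =>
    overpartitions k' m' true n ++
    (if (m <= n)%N then
       [seq (m, c) :: s | c <- (if b then [:: true; false] else [:: false]),
                          s <- overpartitions k' m false (n - m)%N]
     else [::])
  | _, _ => if n == 0%N then [:: [::]] else [::]
  end.

Lemma mem_overpartitions k m b n s : (m + n <= k)%N ->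
  (s \in overpartitions k m b n) = bounded_overpartition m b n s.
Proof.
elim: k m b n s => [|k IHk] [|m] b n s //=.
- rewrite leqn0 addn_eq0 => /andP[_ /eqP ->] /=.
  rewrite inE; case: s => [|[p c] s]; first by rewrite bounded_overpartition_nil.
  rewrite /bounded_overpartition /is_overpartition /=.
  by case: p => [|p]; rewrite ?andbF //= !andbF.
- move=> _; case: s => [|[p c] s].
    by rewrite bounded_overpartition_nil; case: eqP.
  have -> : ((p, c) :: s \in (if n == 0%N then [:: [::]] else [::])) = false.
    by case: ifP.
  rewrite /bounded_overpartition /is_overpartition /=.
  by case: p => [|p]; rewrite ?andbF //= !andbF.
move=> lek; rewrite mem_cat IHk; last by lia.
case: s => [|[p c] s].
  rewrite !bounded_overpartition_nil; case: (m.+1 <= n)%N; rewrite ?orbF //.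
  by case: allpairsP => [[[? ?] [_ _]]|_]; rewrite ?orbF.
rewrite bounded_overpartition_cons.
have tail : ((p, c) :: s \in (if (m < n)%N then
    [seq (m.+1, c0) :: s0 | c0 <- (if b then [:: true; false] else [:: false]),
                          s0 <- overpartitions k m.+1 false (n - m.+1)%N] else [::]))
    = [&& p == m.+1, m.+1 <= n, c ==> b &
          bounded_overpartition m.+1 false (n - m.+1) s]%N.
  case: ltnP => [ltmn|]; last by rewrite andbF.
  rewrite -IHk; last by lia.
  apply/allpairsP/and4P => [[[c0 s0] /= [c0b s0k [-> -> ->]]]|[/eqP -> _ cb sk]].
    by split=> //; move: c0b; case: b c0 => [] [].
  by exists (c, s); split=> //=; move: cb; case: b c => [] [].
rewrite tail; case: eqVneq => [->|_] /=; last by rewrite orbF.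
by rewrite {1}/bounded_overpartition /= ltnn !andbF.
Qed.

Lemma overpartitions_uniq k m b n : (m + n <= k)%N -> uniq (overpartitions k m b n).
Proof.
elim: k m b n => [|k IHk] [|m] b n lek; do ?by rewrite /=; case: eqP.
rewrite /= cat_uniq IHk /=; last by lia.
case: ltnP => //= ltmn; apply/andP; split.
  apply/hasPn => _ /allpairsP[[c s] /= [_ _ ->]].
  rewrite mem_overpartitions /bounded_overpartition /= ?ltnn ?andbF //; lia.
apply: allpairs_uniq => [| |[c s] [c' s'] _ _ /= [-> ->]] //.
  by case: b lek.
by apply: IHk; lia.
Qed.

Definition count_bounded m b := QSeries (fun n => (size (overpartitions (m + n) m b n))%:Z).

Lemma size_overpartitions k m b n : (m + n <= k)%N ->
  (size (overpartitions k m b n))%:Z = count_bounded m b n.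
Proof.
move=> lek /=; congr Posz; apply/perm_size/uniq_perm.
- exact: overpartitions_uniq.
- exact: overpartitions_uniq.
by move=> s; rewrite !mem_overpartitions.
Qed.

Lemma count_bounded0 : count_bounded 0 true = 1.
Proof. by apply: qseriesP => -[|n]. Qed.

Lemma count_boundedS m (b : bool) : count_bounded m.+1 b =
  count_bounded m true + b.+1%:R * ('q ^+ m.+1 * count_bounded m.+1 false).
Proof.
apply: qseriesP => n; rewrite mulr_natl qcoefD qcoefMn qcoefXnM.
rewrite [LHS]/= size_cat PoszD size_overpartitions //; congr (_ + _).
rewrite (ltnNge n); case: ltnP => [ltmn|_]; last by rewrite mul0rn.
rewrite -mulr_natl size_allpairs PoszM size_overpartitions; last by lia.
by case: b.
Qed.

(** Let C_m and D_m count with the flag true and false. By count_boundedS,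
    D_(m+1) (1 - q^(m+1)) = C_m and C_(m+1) = C_m + 2 q^(m+1) D_(m+1). *)
Lemma count_bounded_step m : count_bounded m.+1 true * (1 - 'q ^+ m.+1) =
  count_bounded m true * (1 + 'q ^+ m.+1).
Proof.
have Ct := count_boundedS m true; have Cf := count_boundedS m false.
rewrite -[true.+1%:R]/(2%:R : qseries) in Ct.
rewrite -[false.+1%:R]/(1 : qseries) mul1r in Cf.
have Cm : count_bounded m true = count_bounded m.+1 false * (1 - 'q ^+ m.+1).
  by rewrite [in RHS]mulrBr mulr1 {1}Cf; ring.
by rewrite Ct Cm; ring.
Qed.

Lemma count_bounded_product m :
  count_bounded m true * \prod_(i < m) (1 - 'q ^+ i.+1) =
  \prod_(i < m) (1 + 'q ^+ i.+1).
Proof.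
elim: m => [|m IHm]; first by rewrite !big_ord0 mulr1 count_bounded0.
rewrite !big_ord_recr /= -IHm.
by rewrite (mulrC (\prod_(i < m) _)) mulrA count_bounded_step; ring.
Qed.

Definition overpartition_series := QSeries (fun n => (pbar n)%:Z).

Lemma overpartition_bounds n (s : seq (nat * bool)) : is_overpartition n s ->
  (size s <= n)%N && all (fun x => x.1 <= n)%N s.
Proof.
case/and4P => + _ /eqP <- _; elim: s => //= -[p c] s IHs /andP[/= p1 /IHs /andP[szs les]].
rewrite leq_addr /= andbC; apply/andP; split; last by lia.
by apply: sub_all les => x /leq_trans; apply; apply: leq_addl.
Qed.

Lemma pbar_count_bounded n m : (n <= m)%N -> (pbar n)%:Z = count_bounded m true n.
Proof.
move=> lenm /=; congr Posz; rewrite /pbar cardE.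
set f := fun s : {bseq n of 'I_n.+1 * bool} => [seq (val x.1, x.2) | x <- s].
have f_inj : injective f.
  move=> s t /inj_map st; apply/val_inj/st => -[i b] [j c] /= [ij ->].
  by congr (_, _); apply: val_inj.
rewrite -(size_map f); apply/perm_size/uniq_perm.
- by rewrite map_inj_uniq // enum_uniq.
- exact: overpartitions_uniq.
move=> s; rewrite mem_overpartitions // /bounded_overpartition /= andbT.
apply/mapP/andP => [[t + ->]|[s_op _]].
  rewrite mem_enum inE => t_op; split=> //.
  have /andP[_] := overpartition_bounds t_op.
  by apply: sub_all => x /leq_trans; apply.
have /andP[szs les] := overpartition_bounds s_op.
have szt : (size [seq (inord x.1 : 'I_n.+1, x.2) | x <- s] <= n)%N by rewrite size_map.
have ft : f (Bseq szt) = s.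
  rewrite /f /= -map_comp -[RHS]map_id; apply/eq_in_map => -[p c] /(allP les) /= lepn.
  by rewrite inordK.
by exists (Bseq szt); rewrite // mem_enum inE /= -/(f (Bseq szt)) ft.
Qed.

Lemma overpartition_series_product :
  overpartition_series * euler = poch false 1 1.
Proof.
apply: agree_eq => N.
apply: (@agree_trans _ (count_bounded N true * \prod_(i < N) (1 - 'q ^+ i.+1))).
  apply: agreeM; first by move=> n ltnN; rewrite -(pbar_count_bounded (ltnW ltnN)).
  rewrite (eq_bigr (fun i : 'I_N => 1 + 'q ^+ (1 * i + 1) * sign true)).
    by apply: (agree_le _ (agree_infprod (@poch_multipliable true 1 1 isT isT))).
  by move=> i _; rewrite mul1n addn1 /sign; ring.
rewrite count_bounded_product; apply: agree_sym.
rewrite (eq_bigr (fun i : 'I_N => 1 + 'q ^+ (1 * i + 1) * sign false)).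
  by apply: (agree_le _ (agree_infprod (@poch_multipliable false 1 1 isT isT))).
by move=> i _; rewrite mul1n addn1 /sign; ring.
Qed.

Lemma overpartition_series_phi_neg : overpartition_series * phi_neg = 1.
Proof.
apply: (@mulI_coef0_1 (dil 2 euler)); first by coef0_1.
rewrite mulr1 -[RHS]poch_plus_minus -/euler.
transitivity (overpartition_series * (phi_neg * dil 2 euler)); first by ring.
rewrite phi_neg_product -overpartition_series_product; ring.
Qed.

(** * The overpartitions of 32 n + 12 *)

Lemma sec_dissection4 A B C D : let F := dil 4 A + 'q * dil 4 B + 'q ^+ 2 * dil 4 C
    + 'q ^+ 3 * dil 4 D in
  sec 4 0 F = A /\ sec 4 3 F = D.
Proof.
have e0 : dil 4 A = 'q ^+ (4 * 0 + 0) * dil 4 A by rewrite mul1r.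
have e1 : 'q * dil 4 B = 'q ^+ (4 * 0 + 1) * dil 4 B by [].
have e2 : 'q ^+ 2 * dil 4 C = 'q ^+ (4 * 0 + 2) * dil 4 C by [].
have e3 : 'q ^+ 3 * dil 4 D = 'q ^+ (4 * 0 + 3) * dil 4 D by [].
by rewrite /= e0 e1 e2 e3 !secD !sec_qdil //= !mul1r ?addr0 ?add0r.
Qed.

Section Dissections.

Variable P : qseries.
Hypothesis P_phi_neg : P * phi_neg = 1.

Lemma dil_psi8 : dil 8 psi = dil 4 (dil 2 psi).
Proof. by rewrite dil_dil. Qed.

Lemma dil2_phi_sq : dil 2 phi ^+ 2 = dil 4 phi ^+ 2 + 4%:R * 'q ^+ 2 * dil 4 (dil 2 psi) ^+ 2.
Proof.
rewrite -dilX // phi_sq !(dil_nat, dil_q, dilX, dilM, dilD) //.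
by rewrite !dil_dil.
Qed.

(** As P = 1 / phi(-q), this is phi_phi_neg. *)
Lemma P_dil2 : P = phi * dil 2 P ^+ 2.
Proof.
apply: (@mulI_coef0_1 phi_neg); first by coef0_1.
transitivity ((phi * phi_neg) * dil 2 P ^+ 2); last by ring.
rewrite phi_phi_neg mulrC P_phi_neg -dilX // -dilM // -exprMn mulrC P_phi_neg.
by rewrite expr1n dil1.
Qed.

Lemma P_dil4 : P = phi * dil 2 phi ^+ 2 * dil 4 (P ^+ 4).
Proof.
rewrite {1}P_dil2 {1}P_dil2 !(dilX, dilM) // dil_dil //.
by rewrite -[(2 * 2)%N]/4%N; ring.
Qed.

Lemma sec_P4 : sec 4 0 P = phi ^+ 3 * P ^+ 4.
Proof.
rewrite {1}P_dil4 mulrC sec_dilM // mulrC; congr (_ * _).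
rewrite dil2_phi_sq {1}phi_dissection dil_psi8.
set a := phi; set b := dil 2 psi.
rewrite (_ : _ * _ = dil 4 (a ^+ 3) + 'q * dil 4 (2%:R * a ^+ 2 * b)
  + 'q ^+ 2 * dil 4 (4%:R * a * b ^+ 2) + 'q ^+ 3 * dil 4 (8%:R * b ^+ 3)).
  by have /= [-> _] := sec_dissection4 (a ^+ 3) (2%:R * a ^+ 2 * b) (4%:R * a * b ^+ 2) (8%:R * b ^+ 3).
by ring: (@dil_q 4 isT).
Qed.

(** By P_dil4, phi^3 P^4 is phi^7 phi(q^2)^8 times a series in q^4. If x is the ratio
    of the two terms in the dissection of phi, then phi is proportional to 1 + x
    and phi(q^2)^2 to 1 + x^2, where x is q times a series in q^4; the numbers 63,
    323, 125 and 1 are the coefficients of x^3, x^7, x^11 and x^15 in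
    (1 + x)^7 (1 + x^2)^4. *)
Lemma sec_P16 : sec 4 3 (sec 4 0 P) =
  8%:R * dil 2 psi ^+ 3 * (63%:R * phi ^+ 28
   + 323%:R * 2%:R ^+ 4 * 'q * dil 2 psi ^+ 4 * phi ^+ 24
   + 125%:R * 2%:R ^+ 8 * 'q ^+ 2 * dil 2 psi ^+ 8 * phi ^+ 20
   + 2%:R ^+ 12 * 'q ^+ 3 * dil 2 psi ^+ 12 * phi ^+ 16) * dil 2 (P ^+ 32).
Proof.
rewrite sec_P4.
have -> : phi ^+ 3 * P ^+ 4 =
    dil 4 (phi ^+ 16 * dil 2 (P ^+ 32)) * (phi ^+ 7 * (dil 2 phi ^+ 2) ^+ 4).
  rewrite {1}P_dil4 {1}P_dil2 !(dilX, dilM, dil_dil) //.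
  by rewrite -[(4 * 2)%N]/8%N; ring.
rewrite sec_dilM // dil2_phi_sq [in phi ^+ 7]phi_dissection dil_psi8.
set a := phi; set b := dil 2 psi.
(* The four residues modulo 4 of the exponents of x in the expansion. *)
pose A := 1%:R * a ^+ 15 + 125%:R * 'q * a ^+ 11 * (2%:R * b) ^+ 4
  + 323%:R * 'q ^+ 2 * a ^+ 7 * (2%:R * b) ^+ 8
  + 63%:R * 'q ^+ 3 * a ^+ 3 * (2%:R * b) ^+ 12.
pose B := 7%:R * a ^+ 14 * (2%:R * b) ^+ 1
  + 203%:R * 'q ^+ 1 * a ^+ 10 * (2%:R * b) ^+ 5
  + 277%:R * 'q ^+ 2 * a ^+ 6 * (2%:R * b) ^+ 9
  + 25%:R * 'q ^+ 3 * a ^+ 2 * (2%:R * b) ^+ 13.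
pose C := 25%:R * a ^+ 13 * (2%:R * b) ^+ 2
  + 277%:R * 'q ^+ 1 * a ^+ 9 * (2%:R * b) ^+ 6
  + 203%:R * 'q ^+ 2 * a ^+ 5 * (2%:R * b) ^+ 10
  + 7%:R * 'q ^+ 3 * a ^+ 1 * (2%:R * b) ^+ 14.
pose D := 63%:R * a ^+ 12 * (2%:R * b) ^+ 3
  + 323%:R * 'q ^+ 1 * a ^+ 8 * (2%:R * b) ^+ 7
  + 125%:R * 'q ^+ 2 * a ^+ 4 * (2%:R * b) ^+ 11
  + 'q ^+ 3 * (2%:R * b) ^+ 15.
have split4 : (dil 4 a + 2%:R * 'q * dil 4 b) ^+ 7
    * (dil 4 a ^+ 2 + 4%:R * 'q ^+ 2 * dil 4 b ^+ 2) ^+ 4 =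
    dil 4 A + 'q * dil 4 B + 'q ^+ 2 * dil 4 C + 'q ^+ 3 * dil 4 D.
  by rewrite /A /B /C /D; ring: (@dil_q 4 isT).
rewrite split4; have /= [_ ->] := sec_dissection4 A B C D.
by rewrite /D; ring.
Qed.

(** Replace phi^4 by E(q^2) + q T(q^2), where T = 8 psi^4. The part with even
    exponents is E times a polynomial in E^2 and t = q T^2, and E^2 is
    phi(-q)^8 + t by eis_sq, where P^8 phi(-q)^8 = 1. *)
Lemma sec_P32 : sec 2 0 (sec 4 3 (sec 4 0 P)) =
  let t := 64%:R * 'q * psi ^+ 8 in
  8%:R * psi ^+ 3 * (eis * (63%:R * P ^+ 8 + 23%:R * 2%:R ^+ 8 * t * P ^+ 16
    + 31%:R * 2%:R ^+ 10 * t ^+ 2 * P ^+ 24 + 2%:R ^+ 15 * t ^+ 3 * P ^+ 32)).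
Proof.
rewrite sec_P16 mulrC sec_dilM //.
have -> : phi ^+ 28 = (phi ^+ 4) ^+ 7 by ring.
have -> : phi ^+ 24 = (phi ^+ 4) ^+ 6 by ring.
have -> : phi ^+ 20 = (phi ^+ 4) ^+ 5 by ring.
have -> : phi ^+ 16 = (phi ^+ 4) ^+ 4 by ring.
rewrite phi_pow4; set E := eis.
pose T := 8%:R * psi ^+ 4; pose s := 'q * T ^+ 2.
pose U := E * (63%:R * (E ^+ 6 + 21%:R * E ^+ 4 * s + 35%:R * E ^+ 2 * s ^+ 2 + 7%:R * s ^+ 3)
  + 646%:R * s * (6%:R * E ^+ 4 + 20%:R * E ^+ 2 * s + 6%:R * s ^+ 2)
  + 500%:R * s * (E ^+ 4 + 10%:R * E ^+ 2 * s + 5%:R * s ^+ 2)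
  + 8%:R * s ^+ 2 * (4%:R * E ^+ 2 + 4%:R * s)).
(* The part with odd exponents, which the extraction discards. *)
pose W := T * (63%:R * (7%:R * E ^+ 6 + 35%:R * E ^+ 4 * s + 21%:R * E ^+ 2 * s ^+ 2 + s ^+ 3)
  + 646%:R * (E ^+ 6 + 15%:R * E ^+ 4 * s + 15%:R * E ^+ 2 * s ^+ 2 + s ^+ 3)
  + 500%:R * s * (5%:R * E ^+ 4 + 10%:R * E ^+ 2 * s + s ^+ 2)
  + 8%:R * s * (E ^+ 4 + 6%:R * E ^+ 2 * s + s ^+ 2)).
rewrite [X in sec 2 0 X](_ : _ =
    dil 2 (8%:R * psi ^+ 3 * U) + 'q * dil 2 (8%:R * psi ^+ 3 * W)); last first.
  by rewrite /U /W /s /T; ring: (@dil_q 2 isT).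
have /= [-> _] := sec_dissection2 (8%:R * psi ^+ 3 * U) (8%:R * psi ^+ 3 * W).
have sE : s = 64%:R * 'q * psi ^+ 8 by rewrite /s /T; ring.
rewrite -sE; have Esq : E ^+ 2 = phi_neg ^+ 8 + s by rewrite sE eis_sq.
have D1 : P ^+ 8 * phi_neg ^+ 8 = 1 by rewrite -exprMn P_phi_neg expr1n.
have -> : U = E * (63%:R * ((E ^+ 2) ^+ 3 + 21%:R * (E ^+ 2) ^+ 2 * s
    + 35%:R * E ^+ 2 * s ^+ 2 + 7%:R * s ^+ 3)
  + 646%:R * s * (6%:R * (E ^+ 2) ^+ 2 + 20%:R * E ^+ 2 * s + 6%:R * s ^+ 2)
  + 500%:R * s * ((E ^+ 2) ^+ 2 + 10%:R * E ^+ 2 * s + 5%:R * s ^+ 2)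
  + 8%:R * s ^+ 2 * (4%:R * E ^+ 2 + 4%:R * s)) by rewrite /U; ring.
rewrite Esq; set D := phi_neg ^+ 8; rewrite -/D in D1.
transitivity (8%:R * psi ^+ 3 * (E * (63%:R * P ^+ 8 * (P ^+ 8 * D) ^+ 3
  + 23%:R * 2%:R ^+ 8 * s * P ^+ 16 * (P ^+ 8 * D) ^+ 2
  + 31%:R * 2%:R ^+ 10 * s ^+ 2 * P ^+ 24 * (P ^+ 8 * D) + 2%:R ^+ 15 * s ^+ 3 * P ^+ 32))).
  by ring.
by rewrite D1; ring.
Qed.

End Dissections.

(** * Parametrization by the cubic continued fraction *)

Section Parametrization.

Variable P : qseries.
Hypothesis P_phi_neg : P * phi_neg = 1.

Local Notation a := (dil 9 phi_neg).
(** Ramanujan's cubic continued fraction at q^3, that is q omega(q^3) / phi(-q^9). *)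
Definition cubic_frac : qseries := 'q * dil 3 omega * dil 9 P.
Local Notation v := cubic_frac.

Lemma phi_neg_cubic_frac : phi_neg = a * (1 - 2%:R * v).
Proof.
have aP : dil 9 P * a = 1 by rewrite -dilM // P_phi_neg dil1.
rewrite {1}phi_neg_dissection /cubic_frac.
transitivity (a - 2%:R * 'q * dil 3 omega * (dil 9 P * a)); last by ring.
by rewrite aP mulr1.
Qed.

Lemma psi_cubic_frac : psi = dil 3 alpha * (1 + v).
Proof.
have aP : dil 9 phi_neg * dil 9 P = 1 by rewrite mulrC -dilM // P_phi_neg dil1.
have ao : dil 3 alpha * dil 3 omega = dil 9 psi * dil 9 phi_neg.
  by rewrite -dilM // alpha_omega dilM // !dil_dil.
rewrite {1}psi_dissection /cubic_frac.
transitivity (dil 3 alpha + 'q * (dil 3 alpha * dil 3 omega) * dil 9 P); last by ring.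
rewrite ao.
transitivity (dil 3 alpha + 'q * dil 9 psi * (dil 9 phi_neg * dil 9 P)); last by ring.
by rewrite aP mulr1.
Qed.

Lemma cubic_frac_scaled : a * v = 'q * dil 3 omega.
Proof.
have aP : a * dil 9 P = 1 by rewrite mulrC -dilM // P_phi_neg dil1.
rewrite /cubic_frac.
transitivity ('q * dil 3 omega * (a * dil 9 P)); first by ring.
by rewrite aP mulr1.
Qed.

Lemma phi_neg9_dil : a = dil 3 (dil 3 phi_neg).
Proof. by rewrite dil_dil. Qed.

(** This is cubic_phi at q^3. *)
Lemma phi_neg3_cubic_frac : dil 3 phi_neg ^+ 4 = a ^+ 4 * (1 - 8%:R * v ^+ 3).
Proof.
transitivity (a * (a ^+ 3 - 8%:R * (a * v) ^+ 3)); last by ring.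
rewrite cubic_frac_scaled -dilX // -cubic_phi phi_neg9_dil.
by ring: (@dil_q 3 isT).
Qed.

(** The eighth power of psi_cubic_frac leaves alpha(q^3)^8, which level6_ratio at q^3
    expresses by a and v. *)
Lemma psi_pow8_cubic_frac : 'q * psi ^+ 8 * (1 - 8%:R * v ^+ 3) =
  a ^+ 8 * v * (1 + v ^+ 3) * (1 + v) ^+ 8.
Proof.
rewrite psi_cubic_frac; set d := dil 3 alpha.
suff main : d ^+ 8 * (1 - 8%:R * v ^+ 3) = dil 3 omega * a ^+ 7 * (1 + v ^+ 3).
  transitivity ('q * (d ^+ 8 * (1 - 8%:R * v ^+ 3)) * (1 + v) ^+ 8); first by ring.
  apply: (etrans (congr1 (fun F => 'q * F * (1 + v) ^+ 8) main)).
  transitivity (('q * dil 3 omega) * a ^+ 7 * (1 + v ^+ 3) * (1 + v) ^+ 8); first by ring.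
  by rewrite -cubic_frac_scaled; ring.
apply: (@mulI_coef0_1 (a ^+ 3)); first by coef0_1.
transitivity (d ^+ 8 * (a ^+ 3 - 8%:R * (a * v) ^+ 3)); first by ring.
transitivity (dil 3 omega * a ^+ 7 * (a ^+ 3 + (a * v) ^+ 3)); last by ring.
rewrite cubic_frac_scaled phi_neg9_dil; have := congr1 (dil 3) level6_ratio.
rewrite /d; set A := alpha; set B := dil 3 phi_neg; set C := omega => AB.
transitivity (dil 3 (A ^+ 8 * (B ^+ 3 - 8%:R * 'q * C ^+ 3))).
  by ring: (@dil_q 3 isT).
by rewrite AB; ring: (@dil_q 3 isT).
Qed.

Lemma eis_coef0 : eis 0%N = 1.
Proof.
rewrite /eis qcoefD qcoefX0 theta_coef0 // expr1n !qcoefM0.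
by rewrite (_ : 'q 0%N = 0) // mulr0 mul0r addr0.
Qed.

(** The squares agree, because eis_sq expresses E^2 by phi(-q)^8 and q psi^8, whose
    combination turns out to be the square of a polynomial in v; the constant
    terms decide the sign. *)
Lemma eis_cubic_frac : eis * dil 3 phi_neg ^+ 2 = a ^+ 6 *
  (1 + 24%:R * v + 24%:R * v ^+ 2 + 92%:R * v ^+ 3 - 48%:R * v ^+ 4
   + 96%:R * v ^+ 5 - 8%:R * v ^+ 6).
Proof.
set N := (X in _ = _ * X).
have v0 : v 0%N = 0 by rewrite /cubic_frac !qcoefM0 -[qcoef 'q 0]/(0 : int) !mul0r.
have sq : (eis * dil 3 phi_neg ^+ 2) ^+ 2 = (a ^+ 6 * N) ^+ 2.
  transitivity (eis ^+ 2 * dil 3 phi_neg ^+ 4); first by ring.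
  rewrite eis_sq phi_neg3_cubic_frac.
  transitivity (a ^+ 4 * (phi_neg ^+ 8 * (1 - 8%:R * v ^+ 3)
    + 64%:R * ('q * psi ^+ 8 * (1 - 8%:R * v ^+ 3)))); first by ring.
  by rewrite psi_pow8_cubic_frac [in phi_neg ^+ 8]phi_neg_cubic_frac /N; ring.
apply/eqP; rewrite -subr_eq0; apply/eqP.
apply: (@mulI_coef0_neq0 (eis * dil 3 phi_neg ^+ 2 + a ^+ 6 * N)); last first.
  transitivity ((eis * dil 3 phi_neg ^+ 2) ^+ 2 - (a ^+ 6 * N) ^+ 2); first by ring.
  by rewrite sq subrr.
have e0 : (eis * dil 3 phi_neg ^+ 2) 0%N = 1.
  by apply: coef0_1_mul; [exact: eis_coef0 | coef0_1].
have a0 : a 0%N = 1 by coef0_1.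
have N0 : N 0%N = 1.
  have -> : N = 1 + v * (24%:R + 24%:R * v + 92%:R * v ^+ 2 - 48%:R * v ^+ 3
      + 96%:R * v ^+ 4 - 8%:R * v ^+ 5) by rewrite /N; ring.
  by rewrite qcoefD qcoefM0 v0 mul0r.
by rewrite qcoefD e0 (coef0_1_mul (coef0_1_exp 6 a0) N0).
Qed.

(** (1 - 2v)(1 + 2v + 4v^2) = 1 - 8v^3. *)
Lemma inverse_cubic_frac : P * a * (1 - 8%:R * v ^+ 3) = 1 + 2%:R * v + 4%:R * v ^+ 2.
Proof.
transitivity (P * (a * (1 - 2%:R * v)) * (1 + 2%:R * v + 4%:R * v ^+ 2)); first by ring.
by rewrite -phi_neg_cubic_frac P_phi_neg mul1r.
Qed.

End Parametrization.

(** * Divisibility by 243 *)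

Local Delimit Scope Z_scope with BZ.
Implicit Types p r : seq Z.

(** Polynomials are lists of binary integers, by increasing degree, in order to
    compute with them. *)
Definition zconst (c : Z) : qseries := (int_of_Z c)%:~R.

Fixpoint zeval p (v : qseries) : qseries :=
  if p is c :: p' then zconst c + v * zeval p' v else 0.

Fixpoint zadd p r : seq Z :=
  match p, r with
  | c :: p', d :: r' => c + d :: zadd p' r'
  | [::], _ => r
  | _, [::] => p
  end.
Fixpoint zmul p r : seq Z :=
  if p is c :: p' then zadd [seq c * d | d <- r] (0 :: zmul p' r) else [::].
Definition zexp p k := iter k (zmul p) [:: 1].

Lemma zconstD c d : zconst (c + d) = zconst c + zconst d.
Proof. by rewrite /zconst !rmorphD. Qed.
Lemma zconstM c d : zconst (c * d) = zconst c * zconst d.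
Proof. by rewrite /zconst !rmorphM. Qed.

Lemma zeval_add p r v : zeval (zadd p r) v = zeval p v + zeval r v.
Proof.
elim: p r => [|c p IHp] [|d r] //=; rewrite ?add0r ?addr0 //.
by rewrite IHp zconstD; ring.
Qed.

Lemma zeval_mul p r v : zeval (zmul p r) v = zeval p v * zeval r v.
Proof.
elim: p => [|c p IHp] /=; first by rewrite mul0r.
have scale : zeval [seq c * d | d <- r] v = zconst c * zeval r v.
  by elim: r {IHp} => [|d r IHr] /=; rewrite ?mulr0 // IHr zconstM; ring.
rewrite zeval_add /= IHp scale (_ : zconst 0 = 0); last by rewrite /zconst !rmorph0.
by ring.
Qed.

Lemma zeval_exp p k v : zeval (zexp p k) v = zeval p v ^+ k.
Proof.
elim: k => [|k IHk] /=; last by rewrite zeval_mul IHk exprS.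
by rewrite mulr0 addr0 /zconst !rmorph1.
Qed.

Fixpoint third_coefs_div p : bool :=
  match p with
  | _ :: _ :: c :: p' => Z.eqb (Z.modulo c 243%BZ) 0%BZ && third_coefs_div p'
  | _ => true
  end.

Lemma dil_zconst d c : dil d.+1 (zconst c) = zconst c.
Proof. by rewrite /zconst rmorph_int. Qed.

(** Write v = q u(q^3). As v^3 is a series in q^3, the monomials of index 0, 1 and 2
    modulo 3 have their exponents in the corresponding residue class. *)
Lemma sec_zeval u p F : third_coefs_div p ->
  exists K, sec 3 2 (dil 3 F * zeval p ('q * dil 3 u)) = 243%:R * K.
Proof.
have [m] := ubnP (size p); elim: m p F => // m IHm [|c0 [|c1 [|c2 p]]] F /=.
- by move=> _ _; exists 0; rewrite !mulr0; apply: qseriesP.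
- move=> _ _; exists 0; rewrite !mulr0 addr0 sec_dilM //.
  by rewrite -(dil_zconst 2 c0) sec_dil // mulr0.
- move=> _ _; exists 0; rewrite !mulr0 addr0.
  have [_ _] := sec_dissection3 (F * zconst c0) (F * u * zconst c1) 0.
  rewrite dil0 mulr0 addr0 => <-; congr sec.
  by rewrite -{1}(dil_zconst 2 c0) -{1}(dil_zconst 2 c1); ring.
rewrite !ltnS => size_p /andP[/Z.eqb_spec c2_div p_div].
have [K KE] := IHm p (F * 'q * u ^+ 3) (ltnW (ltnW size_p)) p_div.
have [k c2E] : exists k, c2 = Z.mul 243%BZ k.
  by exists (Z.div c2 243%BZ); have := Z.div_mod c2 243%BZ; rewrite c2_div; lia.
exists (F * u ^+ 2 * zconst k + K); rewrite [RHS]mulrDr -KE.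
set z := zeval p _.
have -> : dil 3 F * (zconst c0 + 'q * dil 3 u * (zconst c1 + 'q * dil 3 u
      * (zconst c2 + 'q * dil 3 u * z))) =
    (dil 3 (F * zconst c0) + 'q * dil 3 (F * u * zconst c1)
     + 'q ^+ 2 * dil 3 (F * u ^+ 2 * zconst c2))
    + dil 3 (F * 'q * u ^+ 3) * z.
  rewrite -{1}(dil_zconst 2 c0) -{1}(dil_zconst 2 c1) -{1}(dil_zconst 2 c2).
  by ring: (@dil_q 3 isT).
rewrite secD; have /= [_ _ ->] := sec_dissection3 (F * zconst c0) (F * u * zconst c1) (F * u ^+ 2 * zconst c2).
by rewrite c2E zconstM; congr (_ + _); rewrite (_ : zconst 243%BZ = 243%:R) //; ring.
Qed.

(** In the notation of zeval_total and gf_cubic_frac, the polynomials in v equal to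
    1 - 8v^3, L, the factor in eis_cubic_frac and t P^8 (1 - 8v^3)^9; poly_total is
    the numerator of the series of sec_P32. *)
Definition poly_W : seq Z := [:: 1; 0; 0; -8]%BZ.
Definition poly_L : seq Z := [:: 1; 2; 4]%BZ.
Definition poly_N : seq Z := [:: 1; 24; 24; 92; -48; 96; -8]%BZ.
Definition poly_tau : seq Z :=
  zmul [:: 0; 64]%BZ (zmul [:: 1; 0; 0; 1]%BZ (zmul (zexp [:: 1; 1]%BZ 8) (zexp poly_L 8))).
Definition poly_total : seq Z :=
  zmul (zexp [:: 1; 1]%BZ 3) (zmul poly_N (zmul (zexp poly_L 8)
    (zadd (zmul [:: 63]%BZ (zexp poly_W 27))
    (zadd (zmul [:: 5888]%BZ (zmul poly_tau (zexp poly_W 18)))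
    (zadd (zmul [:: 31744]%BZ (zmul (zexp poly_tau 2) (zexp poly_W 9)))
          (zmul [:: 32768]%BZ (zexp poly_tau 3))))))).

Lemma poly_total_div : third_coefs_div poly_total.
Proof. by vm_compute. Qed.

Section Divisibility.

Variable P : qseries.
Hypothesis P_phi_neg : P * phi_neg = 1.

Local Notation a := (dil 9 phi_neg).
Local Notation v := (cubic_frac P).
Local Notation W := (1 - 8%:R * v ^+ 3).
Local Notation gf := (sec 2 0 (sec 4 3 (sec 4 0 P))).

Lemma zeval_total : let L := 1 + 2%:R * v + 4%:R * v ^+ 2 in
  let tau := 64%:R * (v * (1 + v ^+ 3) * (1 + v) ^+ 8) * L ^+ 8 in
  zeval poly_total v = (1 + v) ^+ 3 *
  (1 + 24%:R * v + 24%:R * v ^+ 2 + 92%:R * v ^+ 3 - 48%:R * v ^+ 4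
   + 96%:R * v ^+ 5 - 8%:R * v ^+ 6) * L ^+ 8 *
  (63%:R * W ^+ 27 + 23%:R * 2%:R ^+ 8 * tau * W ^+ 18
   + 31%:R * 2%:R ^+ 10 * tau ^+ 2 * W ^+ 9 + 2%:R ^+ 15 * tau ^+ 3).
Proof.
move=> L tau.
have e1 : zeval [:: 1; 1]%BZ v = 1 + v.
  by rewrite /= (_ : zconst 1%BZ = 1) //; ring.
have eW : zeval poly_W v = W.
  rewrite /= (_ : zconst 1%BZ = 1) // (_ : zconst 0%BZ = 0) //.
  by rewrite (_ : zconst (-8)%BZ = - 8%:R) //; ring.
have eL : zeval poly_L v = L.
  rewrite /L /= (_ : zconst 1%BZ = 1) // (_ : zconst 2%BZ = 2%:R) //.
  by rewrite (_ : zconst 4%BZ = 4%:R) //; ring.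
have eN : zeval poly_N v = 1 + 24%:R * v + 24%:R * v ^+ 2 + 92%:R * v ^+ 3
    - 48%:R * v ^+ 4 + 96%:R * v ^+ 5 - 8%:R * v ^+ 6.
  rewrite /= (_ : zconst 1%BZ = 1) // (_ : zconst 24%BZ = 24%:R) //.
  rewrite (_ : zconst 92%BZ = 92%:R) // (_ : zconst (-48)%BZ = - 48%:R) //.
  by rewrite (_ : zconst 96%BZ = 96%:R) // (_ : zconst (-8)%BZ = - 8%:R) //; ring.
have etau : zeval poly_tau v = tau.
  have e64 : zeval [:: 0; 64]%BZ v = 64%:R * v.
    by rewrite /= (_ : zconst 0%BZ = 0) // (_ : zconst 64%BZ = 64%:R) //; ring.
  have e3 : zeval [:: 1; 0; 0; 1]%BZ v = 1 + v ^+ 3.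
    by rewrite /= (_ : zconst 1%BZ = 1) // (_ : zconst 0%BZ = 0) //; ring.
  by rewrite /poly_tau !(zeval_mul, zeval_exp) e1 e3 eL e64 /tau; ring.
have const c : zeval [:: c] v = zconst c by rewrite /= mulr0 addr0.
have pow2 k : zconst (Z.pow 2 (Z.of_nat k)) = 2%:R ^+ k.
  elim: k => // k IHk; rewrite Znat.Nat2Z.inj_succ Z.pow_succ_r; last by lia.
  by rewrite zconstM IHk exprS.
rewrite /poly_total; move: poly_W poly_L poly_N poly_tau eW eL eN etau.
move=> pW pL pN ptau eW eL eN etau.
rewrite !(zeval_mul, zeval_add, zeval_exp, const) e1 eW eL eN etau.
have -> : zconst 5888%BZ = 23%:R * 2%:R ^+ 8 by rewrite -(pow2 8%N) -[23%:R]/(zconst 23%BZ) -zconstM.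
have -> : zconst 31744%BZ = 31%:R * 2%:R ^+ 10 by rewrite -(pow2 10%N) -[31%:R]/(zconst 31%BZ) -zconstM.
have -> : zconst 32768%BZ = 2%:R ^+ 15 by rewrite -(pow2 15%N).
have -> : zconst 63%BZ = 63%:R by [].
by ring.
Qed.

(** The multiplier clears all denominators: with W = 1 - 8v^3 and L = 1 + 2v + 4v^2,
    P a W = L, and t P^8 W^9 is a polynomial in v. In sec_P32 the term t^k P^(8k+8)
    then needs a^8 W^(9k+8), where k <= 3. *)
Lemma gf_cubic_frac : dil 3 phi_neg ^+ 2 * a ^+ 8 * W ^+ 35 * gf =
  8%:R * (dil 3 alpha ^+ 3 * a ^+ 6 * zeval poly_total v).
Proof.
rewrite zeval_total (sec_P32 P_phi_neg) /=.
set t := 64%:R * 'q * psi ^+ 8; set L := 1 + 2%:R * v + 4%:R * v ^+ 2.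
set X := v * (1 + v ^+ 3) * (1 + v) ^+ 8.
set N := 1 + 24%:R * v + 24%:R * v ^+ 2 + 92%:R * v ^+ 3 - 48%:R * v ^+ 4
  + 96%:R * v ^+ 5 - 8%:R * v ^+ 6.
have PaW : P * a * W = L := inverse_cubic_frac P_phi_neg.
have tW : t * W = 64%:R * a ^+ 8 * X.
  by rewrite /t /X -2!mulrA (mulrA 'q) (psi_pow8_cubic_frac P_phi_neg); ring.
have eN : eis * dil 3 phi_neg ^+ 2 = a ^+ 6 * N := eis_cubic_frac P_phi_neg.
move: (1 - 8%:R * v ^+ 3) PaW tW => w PaW tW.
have tau : t * P ^+ 8 * w ^+ 9 = 64%:R * X * L ^+ 8.
  transitivity ((t * w) * P ^+ 8 * w ^+ 8); first by ring.
  by rewrite tW -PaW; ring.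
clearbody t L X N.
have -> : psi ^+ 3 = (dil 3 alpha * (1 + v)) ^+ 3 by rewrite -(psi_cubic_frac P_phi_neg).
transitivity (8%:R * (dil 3 alpha * (1 + v)) ^+ 3 * (eis * dil 3 phi_neg ^+ 2)
  * (P * a * w) ^+ 8
  * (63%:R * w ^+ 27 + 23%:R * 2%:R ^+ 8 * (t * P ^+ 8 * w ^+ 9) * w ^+ 18
     + 31%:R * 2%:R ^+ 10 * (t * P ^+ 8 * w ^+ 9) ^+ 2 * w ^+ 9
     + 2%:R ^+ 15 * (t * P ^+ 8 * w ^+ 9) ^+ 3)); first by ring.
by rewrite eN tau PaW; ring.
Qed.

(** Both the multiplier of gf_cubic_frac and the factor of the polynomial in v are
    series in q^3, so they commute with the extraction; the multiplier has
    constant term 1 and is then removed by its inverse. *)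
Lemma gf_divisible : exists K, sec 3 2 gf = 8%:R * 243%:R * K.
Proof.
pose u := omega * dil 3 P.
have vu : v = 'q * dil 3 u by rewrite /u dilM // dil_dil // mulrA.
pose U := phi_neg ^+ 2 * dil 3 phi_neg ^+ 8 * (1 - 8%:R * ('q * u ^+ 3)) ^+ 35.
pose F := alpha ^+ 3 * dil 3 phi_neg ^+ 6.
have a3 : a = dil 3 (dil 3 phi_neg) by rewrite dil_dil.
have [K] := sec_zeval u F poly_total_div; rewrite -vu.
have := gf_cubic_frac; move: gf (zeval _ _) => G z Gz KE.
have UG : dil 3 U * G = dil 3 8%:R * (dil 3 F * z).
  have -> : dil 3 U = dil 3 phi_neg ^+ 2 * a ^+ 8 * W ^+ 35.
    by rewrite a3 vu /U; ring: (@dil_q 3 isT).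
  by rewrite Gz a3 /F; ring.
have secE : U * sec 3 2 G = 8%:R * (243%:R * K).
  by rewrite -KE -(sec_dilM (d := 3)) // UG sec_dilM.
have [Y UY] : exists Y, U * Y = 1.
  apply: inverse_exists; apply: coef0_1_mul; first by coef0_1.
  apply: coef0_1_exp; rewrite qcoefB !qcoefM0 -[qcoef 'q 0]/(0 : int).
  by rewrite mul0r mulr0 subr0.
exists (Y * K); transitivity (U * Y * sec 3 2 G); first by rewrite UY mul1r.
by rewrite mulrAC secE; ring.
Qed.

End Divisibility.
Local Close Scope ring_scope.

Theorem theorem3p5 (n : nat) : pbar (96 * n + 76) = 0 %[mod 2 ^ 3 * 3 ^ 5].
Proof.
have [K KE] := gf_divisible overpartition_series_phi_neg.
have pE : (Posz (pbar (96 * n + 76)) = K n *+ (8 * 243))%R.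
  rewrite -qcoefMn -mulr_natl natrM -KE /=; congr (Posz (pbar _)); lia.
apply/eqP; rewrite mod0n -/(dvdn _ _).
have : (Posz (8 * 243) %| Posz (pbar (96 * n + 76)))%Z.
  by rewrite pE -mulr_natr natz dvdz_mull.
by rewrite dvdzE.
Qed.
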